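(* Let $\kappa$ be a set (which may be taken to be a cardinal), and let $a,b:\kappa\to[-1,1]$ be functions with $a(i)<b(i)$ for all $i\in\kappa$ and $\mu(a,b)=\sum_{i\in\kappa}\bigl(a(i)^+ + b(i)^-\bigr)<1$. Then the space $B(\kappa,a,b)$ is homeomorphic to $B(\kappa)$.
   Context: For a set $\kappa$, $B(\kappa)=\{x\in[-1,1]^\kappa:\sum_{i\in\kappa}|x_i|\le 1\}$, with the topology inherited from the product topology on $[-1,1]^\kappa$. For functions $a,b:\kappa\to[-1,1]$ with $a(i)<b(i)$ for all $i$, $B(\kappa,a,b)=\{x\in\mathbb{R}^\kappa:\sum_{i\in\kappa}|x_i|\le 1,\ a(i)\le x_i\le b(i)\text{ for all }i\in\kappa\}$, with the topology inherited from the product topology on $\mathbb{R}^\kappa$. Here $t^+=\max\{t,0\}$ and $t^-=\max\{-t,0\}$ for a real number $t$. *)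

(* Defs.v *)
From HB Require Import structures.
From mathcomp Require Import all_boot all_order all_algebra.
From mathcomp Require Import all_classical all_reals all_analysis.

Set Implicit Arguments.
Unset Strict Implicit.
Unset Printing Implicit Defensive.
Import Order.TTheory GRing.Theory Num.Theory.
Import numFieldNormedType.Exports.

Local Open Scope classical_set_scope.
Local Open Scope ring_scope.

(* Sets of points are used as types throughout; such a type carries the
   subspace topology. *)

Definition homeomorphic (S T : topologicalType) (X : set S) (Y : set T) : Prop :=
  exists (f : X -> Y) (g : Y -> X),
    [/\ continuous f, continuous g, cancel f g & cancel g f].

(* K is an arbitrary index set, possibly empty or uncountable: esum only needs
   the choiceType structure, which every type has classically.  All sums have
   nonnegative terms and are taken in \bar R as suprema of finite subsums. *)

Definition ball1 (R : realType) (K : choiceType) :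
    set {ptws K -> (`[-1, 1]%classic : set R)} :=
  [set x | (\esum_(i in [set: K]) `|set_val (x i)|%:E <= 1)%E].
Arguments ball1 : clear implicits.

Definition ball1_between (R : realType) (K : choiceType) (a b : K -> R) :
    set {ptws K -> R} :=
  [set x | (\esum_(i in [set: K]) `|x i|%:E <= 1)%E /\
           forall i, a i <= x i <= b i].

Definition mu (R : realType) (K : choiceType) (a b : K -> R) : \bar R :=
  \esum_(i in [set: K]) (a^\+ i + b^\- i)%:E.

(* Main.v *)
Require Import Defs.
From mathcomp Require Import all_boot all_order all_algebra finmap.
From mathcomp Require Import all_classical all_reals all_analysis.
From mathcomp Require Import ring lra.
Import Order.TTheory GRing.Theory Num.Theory.
Import numFieldNormedType.Exports.
Local Open Scope classical_set_scope.
Local Open Scope ring_scope.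
Set Implicit Arguments.
Unset Strict Implicit.
Unset Printing Implicit Defensive.

(* After an affine change of coordinates, a <= 0 < b and -a <= b. If the b i are
   summable, finitely many coordinates carry all but 1/2 of their sum, and a
   radial dilation in these coordinates identifies the ball with the box, hence
   with a cube. Otherwise Zorn's lemma splits the index set into countable blocks
   over each of which b has infinite sum. In such a block the intervals [a, b]
   are straightened one coordinate at a time by planar homeomorphisms preserving
   the l1 norm, which exchange a coordinate against a reservoir coming from
   infinity. Since norms are preserved, the blocks can be treated simultaneously,
   and the ball becomes the simplex {z >= 0, sum z <= 1}, whatever a and b are.
   Finally the simplex on a countable infinite set is a Hilbert cube, which links
   the unit ball to the summable case. *)

(** * Continuous bijections from compact sets *)

(** The obstacle is that the l1 norm is only lower semicontinuous for the product topology: mass can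
    escape to infinity. Rescaling by a norm is therefore safe only where a summable bound dominates
    the coordinates, and this forces the two cases. The infinite constructions are encoded as
    compact graphs carrying an auxiliary sequence. Each component of the two maps out of a graph
    depends on finitely many coordinates, so continuity is immediate, and compactness gives that of
    the inverses. What remains is bijectivity. The auxiliary sequence solves an affine recursion
    running in from infinity, whose bounded solution is unique once the products of its coefficients
    vanish; divergence of the sum of b over a block is what makes them vanish. The cases meet
    because positive summable bounds force a countable index set, and over an infinite one the unit
    ball is itself a single divergent block. The condition on [mu] leaves the mass 1 - mu for the
    rescaling after recentring. *)

Lemma homeomorphic_sym (S T : topologicalType) (X : set S) (Y : set T) :
  homeomorphic X Y -> homeomorphic Y X.
Proof. by case=> f [g [cf cg fK gK]]; exists g, f. Qed.

Lemma homeomorphic_trans (S T U : topologicalType) (X : set S) (Y : set T)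
    (Z : set U) :
  homeomorphic X Y -> homeomorphic Y Z -> homeomorphic X Z.
Proof.
case=> f [g [cf cg fK gK]] [f' [g' [cf' cg' fK' gK']]].
exists (f' \o f), (g \o g'); split.
- by move=> x; apply: continuous_comp; [exact: cf|exact: cf'].
- by move=> x; apply: continuous_comp; [exact: cg'|exact: cg].
- exact: can_comp.
- exact: can_comp.
Qed.

Lemma continuous_set_type (S T : topologicalType) (X : set S) (f : S -> T) :
  {within X, continuous f} -> continuous (fun x : X => f (set_val x)).
Proof. by move/subspace_sigL_continuousP. Qed.

Lemma continuous_into_set_type (S T : topologicalType) (Y : set T) (f : S -> Y) :
  continuous (fun x => set_val (f x)) -> continuous f.
Proof.
move=> cf; apply/continuousP => _ [V oV <-].
rewrite -comp_preimage.
by move/continuousP : cf => /(_ _ oV).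
Qed.

Lemma hausdorff_set_type (T : topologicalType) (Y : set T) :
  hausdorff_space T -> hausdorff_space Y.
Proof.
move=> hT p q clpq; apply/val_inj/hT => A B nA nB.
have cv : continuous (set_val : Y -> T) := @initial_continuous _ _ _.
have [z [Az Bz]] := clpq _ _ (cv _ _ nA) (cv _ _ nB).
by exists (set_val z).
Qed.

Lemma compact_set_type (S : topologicalType) (X : set S) :
  compact X -> compact [set: X].
Proof.
move=> cX F PF _.
pose G : set_system S := (set_val : X -> S) @ F.
have GX : G X.
  suff : F [set x : X | X (set_val x)] by [].
  by apply: filterE => x; exact: set_valP.
have [x [Xx clx]] := cX G _ GX.
exists (SigSub (mem_set Xx)); split => // A B FA [_ [[V oV <-] /= Vx sVB]].
have [||y [[z Az <-] Vy]] := clx (set_val @` A) V.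
- suff : F [set z : X | (set_val @` A) (set_val z)] by [].
  by apply: filterS FA => z Az; exists z.
- by apply: open_nbhs_nbhs; split => //; exact: Vx.
by exists z; split => //; exact: sVB.
Qed.

Lemma continuous_bij_homeomorphic (S T : topologicalType) (X : set S)
    (Y : set T) (f : S -> T) :
  compact X -> hausdorff_space T -> {within X, continuous f} ->
  set_bij X Y f -> homeomorphic X Y.
Proof.
move=> cX hT cf [fXY finj fsurj].
have fY (x : X) : f (set_val x) \in Y by apply/mem_set/fXY/set_valP.
pose F (x : X) : Y := SigSub (fY x).
have Fsurj (y : Y) : exists x, F x = y.
  have [x Xx fx] := fsurj _ (set_valP y).
  by exists (SigSub (mem_set Xx)); apply: val_inj.
have Finj : injective F.
  move=> x x' /(congr1 val)/= e; apply/val_inj/finj => //;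
  exact/mem_set/set_valP.
have [G GK] := choice Fsurj.
have FK : cancel F G by move=> x; apply: Finj; rewrite GK.
have cF : continuous F.
  exact/continuous_into_set_type/continuous_set_type.
exists F, G; split => //.
apply/continuous_closedP => C cC.
have -> : G @^-1` C = F @` C.
  by apply/seteqP; split => [y Cy|_ [x Cx <-]/=];
    [exists (G y); rewrite ?GK|rewrite /preimage/= FK].
apply: compact_closed; first exact: hausdorff_set_type.
apply: continuous_compact; first exact: continuous_subspaceT.
by apply: subclosed_compact (compact_set_type cX) _.
Qed.

Section pointwise.
Context {R : realType}.

Lemma ptws_hausdorff (I : choiceType) : hausdorff_space {ptws I -> R}.
Proof. by apply: hausdorff_product => i; exact: Rhausdorff. Qed.

Lemma ptws_eval_continuous (I : choiceType) (i : I) :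
  continuous (fun x : {ptws I -> R} => x i).
Proof. exact: proj_continuous. Qed.

Lemma ptws_continuous (S : topologicalType) (L : choiceType) (T : topologicalType)
    (f : S -> {ptws L -> T}) :
  (forall l, continuous (fun x => f x l)) -> continuous f.
Proof.
move=> cf x; apply/cvg_sup => l.
move=> A [_ [[V oV <-] /= Vfx sVA]]; apply: filterS sVA _.
by apply: (cf l x); apply: open_nbhs_nbhs; split.
Qed.

Lemma ptws_compact (I : choiceType) (X : set {ptws I -> R}) (A : I -> R) :
  closed X -> (forall x, X x -> forall i, `|x i| <= A i) -> compact X.
Proof.
move=> cX XA.
apply: (@subclosed_compact _ _
  [set x : {ptws I -> R} | forall i, `[- A i, A i]%classic (x i)]) => //.
  apply: (@tychonoff I (fun=> R) (fun i => `[- A i, A i]%classic)) => i.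
  exact: segment_compact.
by move=> x Xx i /=; rewrite in_itv/= -ler_norml; exact: XA.
Qed.

Lemma ptws_homeomorphic (I L : choiceType) (X : set {ptws I -> R})
    (Y : set {ptws L -> R}) (A : I -> R) (f : {ptws I -> R} -> {ptws L -> R}) :
  closed X -> (forall x, X x -> forall i, `|x i| <= A i) ->
  (forall l, {within X, continuous (fun x => f x l)}) ->
  set_bij X Y f -> homeomorphic X Y.
Proof.
move=> cX XA cf; apply: continuous_bij_homeomorphic.
- exact: ptws_compact XA.
- exact: ptws_hausdorff.
- exact: ptws_continuous.
Qed.

End pointwise.

(** * Sums of nonnegative families *)

Section esum_real.
Context {R : realType}.

Lemma esum_leP (I : choiceType) (f : I -> R) (M : R) :
  (forall i, 0 <= f i) ->
  (\esum_(i in [set: I]) (f i)%:E <= M%:E)%E <->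
  (forall s : seq I, uniq s -> \sum_(i <- s) f i <= M).
Proof.
move=> f0; split=> [leM s us|leM].
  rewrite -lee_fin; apply: le_trans leM; apply: esum_ge.
  exists [set` s]; first by split; [exact: finite_seq|].
  by rewrite -fsbig_seq//= sumEFin.
apply: ge_ereal_sup => _ [X [finX _] <-].
by rewrite fsbig_finite//= sumEFin lee_fin; apply: leM; exact: fset_uniq.
Qed.

(** The index N' may depend on e: along a chain of shears, mass found in the first N terms of u can
    come from much later terms of v. *)
Lemma esum_nat_le (u v : nat -> R) :
  (forall n, 0 <= u n) -> (forall n, 0 <= v n) ->
  (forall N e, 0 < e ->
    exists N', \sum_(i < N) u i <= \sum_(i < N') v i + e) ->
  (\esum_(n in [set: nat]) (u n)%:E <= \esum_(n in [set: nat]) (v n)%:E)%E.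
Proof.
move=> u0 v0 uv; rewrite -!nneseries_esumT; [|by move=> n; rewrite lee_fin..].
apply: lime_le; first by apply: is_cvg_nneseries => n _ _; rewrite lee_fin.
apply: nearW => N; apply/lee_addgt0Pr => e e0.
have [N' leN] := uv N e e0.
apply: (@le_trans _ _ (\sum_(0 <= i < N') (v i)%:E + e%:E)%E).
  by rewrite !sumEFin -EFinD lee_fin !big_mkord.
by rewrite leeD2r//; apply: nneseries_lim_ge => n _ _; rewrite lee_fin.
Qed.

Lemma esum_nat_lb (u : nat -> R) (N : nat) :
  (forall n, 0 <= u n) ->
  ((\sum_(i < N) u i)%:E <= \esum_(n in [set: nat]) (u n)%:E)%E.
Proof.
move=> u0; rewrite -nneseries_esumT; last by move=> n; rewrite lee_fin.
rewrite -(big_mkord xpredT) -sumEFin.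
by apply: nneseries_lim_ge => n _ _; rewrite lee_fin.
Qed.

Lemma esum_pair (J : choiceType) (f : J * nat -> \bar R) :
  (forall p, 0 <= f p)%E ->
  (\esum_(p in [set: J * nat]) f p =
   \esum_(j in [set: J]) \esum_(n in [set: nat]) f (j, n))%E.
Proof.
move=> f0; rewrite esum_esum//.
have -> : [set: J] `*`` (fun=> [set: nat]) = [set: J * nat].
  by apply/seteqP; split.
by apply: eq_esum => -[].
Qed.

Lemma esum_row_le (J : choiceType) (f : J * nat -> \bar R) (j : J) :
  (forall p, 0 <= f p)%E ->
  (\esum_(n in [set: nat]) f (j, n) <= \esum_(p in [set: J * nat]) f p)%E.
Proof.
move=> f0; rewrite esum_pair//.
rewrite -[leLHS](@esum_set1 _ _ j (fun j => \esum_(n in [set: nat]) f (j, n))%E);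
  last exact: esum_ge0.
rewrite [leRHS](esumID [set j])//; last by move=> *; exact: esum_ge0.
rewrite setTI leeDl//; apply: esum_ge0 => *; exact: esum_ge0.
Qed.

Lemma esum_fin_num (I : choiceType) (D : set I) (f : I -> R) :
  (forall i, 0 <= f i) -> (\esum_(i in D) (f i)%:E < +oo)%E ->
  (\esum_(i in D) (f i)%:E = (fine (\esum_(i in D) (f i)%:E))%:E)%E.
Proof.
move=> f0 foo; rewrite fineK// ge0_fin_numE//.
by apply: esum_ge0 => i _; rewrite lee_fin.
Qed.

Lemma esum_term_le (I : choiceType) (f : I -> R) (M : R) i :
  (forall i, 0 <= f i) -> (\esum_(i in [set: I]) (f i)%:E <= M%:E)%E ->
  f i <= M.
Proof.
move=> f0 /(esum_leP _ f0)/(_ [:: i] isT).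
by rewrite big_seq1.
Qed.

Lemma continuous_add (S : topologicalType) (f g : S -> R) :
  continuous f -> continuous g -> continuous (fun x => f x + g x).
Proof. by move=> cf cg x; apply: cvgD; [exact: cf|exact: cg]. Qed.

Lemma continuous_sub (S : topologicalType) (f g : S -> R) :
  continuous f -> continuous g -> continuous (fun x => f x - g x).
Proof. by move=> cf cg x; apply: cvgB; [exact: cf|exact: cg]. Qed.

Lemma continuous_mul (S : topologicalType) (f g : S -> R) :
  continuous f -> continuous g -> continuous (fun x => f x * g x).
Proof. by move=> cf cg x; apply: cvgM; [exact: cf|exact: cg]. Qed.

Lemma closed_fun_le (S : topologicalType) (f g : S -> R) :
  continuous f -> continuous g -> closed [set x | f x <= g x].
Proof.
move=> cf cg.
rewrite (_ : [set _ | _] = (fun x => g x - f x) @^-1` [set y | 0 <= y]).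
  by apply: closed_comp (@closed_ge _ _) => x _; apply: cvgB; [exact: cg|exact: cf].
by apply/seteqP; split => x /=; rewrite subr_ge0.
Qed.

Lemma closed_fun_eq (S : topologicalType) (f g : S -> R) :
  continuous f -> continuous g -> closed [set x | f x = g x].
Proof.
move=> cf cg.
rewrite (_ : [set _ | _] = [set x | f x <= g x] `&` [set x | g x <= f x]).
  by apply: closedI; exact: closed_fun_le.
apply/seteqP; split => x /=; first by move=> ->.
by case=> fg gf; apply/eqP; rewrite eq_le fg gf.
Qed.

Lemma closed_forall (S : topologicalType) (I : Type) (A : I -> set S) :
  (forall i, closed (A i)) -> closed [set x | forall i, A i x].
Proof.
move=> cA; rewrite (_ : [set _ | _] = \bigcap_(i in [set: I]) A i).
  by apply: closed_bigI => i _; exact: cA.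
by apply/seteqP; split => x /= H i; [move=> _; exact: H|exact: H].
Qed.

Lemma continuous_sum_seq (S : topologicalType) (I : Type) (f : I -> S -> R) (s : seq I) :
  (forall i, continuous (f i)) -> continuous (fun x => \sum_(i <- s) f i x).
Proof.
move=> cf; elim: s => [|i s IH] x.
  under eq_fun do rewrite big_nil.
  exact: cvg_cst.
under eq_fun do rewrite big_cons.
by apply: cvgD; [exact: cf|exact: IH].
Qed.

(** This is lower semicontinuity: the bound is an intersection of closed conditions, one for each
    finite subsum. *)
Lemma closed_esum_le (S : topologicalType) (I : choiceType) (f : I -> S -> R) (M : R) :
  (forall i, continuous (f i)) -> (forall i x, 0 <= f i x) ->
  closed [set x | (\esum_(i in [set: I]) (f i x)%:E <= M%:E)%E].
Proof.
move=> cf f0.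
rewrite (_ : [set _ | _] =
  [set x | forall s : seq I, uniq s -> \sum_(i <- s) f i x <= M]).
  apply: (closed_forall
    (A := fun s => [set x | uniq s -> \sum_(i <- s) f i x <= M])) => s.
  have [us|nus] := boolP (uniq s); last first.
    rewrite (_ : [set _ | _] = setT) ?closedT//.
    by apply/seteqP; split.
  rewrite (_ : [set _ | _] = [set x | \sum_(i <- s) f i x <= M]); last first.
    by apply/seteqP; split => x /=; [apply|].
  by apply: closed_fun_le; [exact: continuous_sum_seq|exact: cst_continuous].
by apply/seteqP; split => x /=; move/esum_leP; apply.
Qed.

Definition simplex (I : choiceType) : set {ptws I -> R} :=
  [set z | (\esum_(i in [set: I]) (z i)%:E <= 1)%E /\ forall i, 0 <= z i].

Definition cube (I : Type) : set {ptws I -> R} :=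
  [set t | forall i, 0 <= t i <= 1].

Lemma continuous_abs (S : topologicalType) (f : S -> R) :
  continuous f -> continuous (fun x => `|f x|).
Proof. by move=> cf x; apply: cvg_norm; exact: cf. Qed.

Definition box (I : Type) (a b : I -> R) : set {ptws I -> R} :=
  [set x | forall i, a i <= x i <= b i].

Lemma closed_box (I : choiceType) (a b : I -> R) : closed (box a b).
Proof.
apply: (closed_forall
  (A := fun i => [set x : {ptws I -> R} | a i <= x i <= b i])) => i.
rewrite (_ : [set _ | _] = [set x | a i <= x i] `&` [set x | x i <= b i]).
  by apply: closedI; apply: closed_fun_le;
    [exact: cst_continuous|exact: ptws_eval_continuous|
     exact: ptws_eval_continuous|exact: cst_continuous].
by apply/seteqP; split => x /= => [/andP//|[-> ->]].
Qed.

Lemma closed_cube (I : choiceType) : closed (@cube I).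
Proof. exact: (@closed_box I (fun=> 0) (fun=> 1)). Qed.

Lemma closed_ball1_between (I : choiceType) (a b : I -> R) :
  closed (ball1_between a b).
Proof.
apply: closedI; last exact: closed_box.
apply: (@closed_esum_le _ _ (fun i (x : {ptws I -> R}) => `|x i|)) => // i.
exact/continuous_abs/ptws_eval_continuous.
Qed.

Lemma ball1_between_le1 (I : choiceType) (a b : I -> R) x :
  ball1_between a b x -> forall i, `|x i| <= 1.
Proof. by case=> x1 _ i; apply: (esum_term_le (f := fun i => `|x i|)) x1. Qed.

End esum_real.
Arguments simplex R I : clear implicits.
Arguments cube R I : clear implicits.

(** * Affine recursions and a planar map *)

Section affine_recursion.
Context {R : realType}.
Implicit Types (p l m B : nat -> R).

(** B is a supersolution. The iterates started from 0 increase and stay below B, and their limit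
    solves the recursion. Cutting the recursion off with value 0 after k steps and letting k grow is
    what starting from 0 at infinity means. *)
Lemma affine_recursion_ex p l B :
  (forall n, 0 <= p n) -> (forall n, 0 <= l n) -> (forall n, 0 <= B n) ->
  (forall n, p n + l n * B n.+1 <= B n) ->
  exists m, forall n, 0 <= m n <= B n /\ m n = p n + l n * m n.+1.
Proof.
move=> p0 l0 B0 pB.
pose M k := iter k (fun (f : nat -> R) n => p n + l n * f n.+1) (fun=> 0).
have M0B k n : 0 <= M k n <= B n.
  elim: k n => [|k IH] n; first by rewrite lexx B0.
  have /andP[M0 MB] := IH n.+1; apply/andP; split => /=.
    by rewrite addr_ge0// mulr_ge0.
  by apply: le_trans (pB n); rewrite lerD2l ler_wpM2l.
have Mnd n : nondecreasing_seq (M^~ n).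
  apply/nondecreasing_seqP => k.
  elim: k n => [|k IH] n; first by case/andP: (M0B 1%N n).
  by rewrite /= lerD2l ler_wpM2l//; exact: IH.
have cM n : cvgn (M^~ n).
  apply: nondecreasing_is_cvgn; first exact: Mnd.
  by exists (B n) => _ [k _ <-]; case/andP: (M0B k n).
exists (fun n => limn (M^~ n)) => n; split.
  apply/andP; split.
    by apply: limr_ge; [exact: cM|apply: nearW => k; case/andP: (M0B k n)].
  by apply: limr_le; [exact: cM|apply: nearW => k; case/andP: (M0B k n)].
apply: cvg_lim => //; rewrite -cvg_shiftS /=.
apply: cvgD; first exact: cvg_cst.
by apply: cvgM; [exact: cvg_cst|exact: cM].
Qed.

Lemma affine_recursion_iter l (d : nat -> R) :
  (forall n, 0 <= l n) -> (forall n, `|d n| <= l n * `|d n.+1|) ->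
  forall n k, `|d n| <= (\prod_(i < k) l (n + i)%N) * `|d (n + k)%N|.
Proof.
move=> l0 dl n; elim=> [|k IH]; first by rewrite big_ord0 mul1r addn0.
rewrite big_ord_recr /= -mulrA addnS; apply: (le_trans IH).
by rewrite ler_wpM2l//; apply: prodr_ge0 => i _.
Qed.

(** The difference of two solutions obeys the homogeneous recursion, so at n it is at most a product
    of k coefficients times 2 * C. *)
Lemma affine_recursion_uniq p l m m' (C : R) :
  (forall n, 0 <= l n) ->
  (forall n e, 0 < e -> exists k, \prod_(i < k) l (n + i)%N <= e) ->
  (forall n, `|m n| <= C) -> (forall n, `|m' n| <= C) ->
  (forall n, m n = p n + l n * m n.+1) ->
  (forall n, m' n = p n + l n * m' n.+1) -> m =1 m'.
Proof.
move=> l0 lsmall mC m'C rm rm' n.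
have C0 : 0 <= C by exact: le_trans (mC 0%N).
pose d n := m n - m' n.
have dl k : `|d k| <= l k * `|d k.+1|.
  by rewrite -[l k]ger0_norm// -normrM /d rm rm' le_eqVlt; apply/orP; left;
    apply/eqP; congr (`|_|); ring.
have dC k : `|d k| <= 2 * C.
  by apply: (le_trans (ler_normB _ _)); have := mC k; have := m'C k; lra.
apply/eqP; rewrite -subr_eq0 -normr_le0; apply/ler_addgt0Pr => e e0.
rewrite add0r.
(* The summand 1 keeps the denominator positive when C = 0. *)
have [|k lk] := lsmall n (e / (2 * C + 1)); first by apply: divr_gt0 => //; lra.
apply: (le_trans (affine_recursion_iter l0 dl n k)).
apply: (@le_trans _ _ (e / (2 * C + 1) * (2 * C + 1))).
  apply: ler_pM => //; first by apply: prodr_ge0.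
  by have := dC (n + k)%N; lra.
by rewrite divfK// gt_eqF//; lra.
Qed.

End affine_recursion.

Section hilbert_cube.
Context {R : realType}.

Lemma quadratic_ivt (a b c lo hi : R) : lo <= hi ->
  a * lo ^+ 2 + b * lo + c <= 0 <= a * hi ^+ 2 + b * hi + c ->
  exists2 x, lo <= x <= hi & a * x ^+ 2 + b * x + c = 0.
Proof.
move=> lohi H.
pose P : {poly R} := a *: 'X^2 + b *: 'X + c%:P.
have PE x : P.[x] = a * x ^+ 2 + b * x + c.
  by rewrite /P !hornerE.
have [|x xI /rootP] := @poly_ivt R P lo hi lohi; first by rewrite !PE.
by rewrite PE => Px; exists x.
Qed.

(* The unit square is mapped homeomorphically onto the triangle
   {x, v >= 0, x + v <= 1} by (t, w) |-> (t (1 + w) / 2, (1 - t) w): the side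
   w = 1 covers the hypotenuse, and the first coordinate contracts in w by 1/2,
   which is what makes the infinite iteration below injective. *)
Lemma square_to_triangle_inj (t w t' w' : R) :
  0 <= t <= 1 -> 0 <= w <= 1 -> 0 <= t' <= 1 -> 0 <= w' <= 1 ->
  t * (1 + w) / 2 = t' * (1 + w') / 2 -> (1 - t) * w = (1 - t') * w' ->
  t = t' /\ w = w'.
Proof.
(* If u < u', equality of the first coordinates forces v' < v, and then the second coordinate is
   strictly smaller at (u', v'). *)
have lt_false (u v u' v' : R) : 0 <= u <= 1 -> 0 <= v <= 1 -> 0 <= u' <= 1 ->
    0 <= v' <= 1 ->
    u * (1 + v) / 2 = u' * (1 + v') / 2 -> (1 - u) * v = (1 - u') * v' ->
    ~ u < u'.
  move=> /andP[u0 u1] /andP[v0 v1] /andP[u'0 u'1] /andP[v'0 v'1] e1 e2 uu'.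
  have e1' : u * (1 + v) = u' * (1 + v') by lra.
  have vv' : v' < v.
    rewrite ltNge; apply/negP => vv'.
    have : u * (1 + v) < u' * (1 + v') by nra.
    by rewrite e1' ltxx.
  have : (1 - u') * v' < (1 - u) * v by nra.
  by rewrite e2 ltxx.
move=> ht hw ht' hw' e1 e2.
have tt' : t = t'.
  have n1 := lt_false _ _ _ _ ht hw ht' hw' e1 e2.
  have n2 := lt_false _ _ _ _ ht' hw' ht hw (esym e1) (esym e2).
  by apply/eqP; rewrite eq_le !leNgt; apply/andP; split; apply/negP.
split=> //; subst t'.
have : t * (w - w') = 0 by lra.
move/eqP; rewrite mulf_eq0 => /orP[/eqP t0|/eqP]; last by lra.
by move: e2; rewrite t0; lra.
Qed.

(** Substituting t = 2 * x / (1 + w) into (1 - t) * w = v gives a quadratic equation in w. A root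
    above 2 * x - 1 makes t at most 1. *)
Lemma square_to_triangle_surj (x v : R) : 0 <= x -> 0 <= v -> x + v <= 1 ->
  exists t w : R, [/\ 0 <= t <= 1, 0 <= w <= 1, t * (1 + w) / 2 = x &
                      (1 - t) * w = v].
Proof.
move=> x0 v0 xv.
have [||w /andP[lw w1] ew] := @quadratic_ivt 1 (1 - 2 * x - v) (- v)
    (Num.max 0 (2 * x - 1)) 1.
- by rewrite ge_max ler01/=; lra.
- by apply/andP; split; [case: (leP 0 (2 * x - 1)) => h; nra|lra].
move: lw; rewrite ge_max => /andP[w0 xw].
exists (2 * x / (1 + w)), w; split.
- by rewrite divr_ge0 ?ler_pdivrMr; lra.
- by rewrite w0.
- by field; lra.
- have -> : 1 - 2 * x / (1 + w) = (1 + w - 2 * x) / (1 + w) by field; lra.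
  apply: (@mulIf _ (1 + w)); first lra.
  rewrite mulrAC divfK; last lra.
  by lra.
Qed.

End hilbert_cube.

(** * The simplex on a countable set is a Hilbert cube *)

Section hilbert_cube_simplex.
Context {R : realType}.

Lemma esum_nat_leP (u : nat -> R) (M : R) : (forall n, 0 <= u n) ->
  (\esum_(n in [set: nat]) (u n)%:E <= M%:E)%E <->
  (forall N, \sum_(i < N) u i <= M).
Proof.
move=> u0; split=> [uM N|uM].
  by rewrite -lee_fin; apply: le_trans uM; exact: esum_nat_lb.
rewrite -nneseries_esumT; last by move=> n; rewrite lee_fin.
apply: lime_le; first by apply: is_cvg_nneseries => n _ _; rewrite lee_fin.
by apply: nearW => N; rewrite sumEFin lee_fin big_mkord.
Qed.

(** The index set [unit * nat] is that of a decomposition into a single block, which lets this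
    simplex be matched with the one of the block construction. *)
Lemma simplex_unit_natP (z : unit * nat -> R) :
  simplex R (unit * nat)%type z <->
  (forall n, 0 <= z (tt, n)) /\ (forall N, \sum_(i < N) z (tt, val i) <= 1).
Proof.
have H : (forall n, 0 <= z (tt, n)) ->
    (\esum_(p in [set: unit * nat]) (z p)%:E =
     \esum_(n in [set: nat]) (z (tt, n))%:E)%E.
  move=> z0; rewrite esum_pair; last by move=> [[] n]; rewrite lee_fin.
  rewrite (_ : [set: unit] = [set tt]); last by apply/seteqP; split => -[].
  by rewrite esum_set1//; apply: esum_ge0 => n _; rewrite lee_fin.
split=> [[z1 z0]|[z0 z1]].
  by split => //; apply/(esum_nat_leP (u := fun n => z (tt, n))); rewrite -?H.
split; last by case=> -[].
by rewrite H//; apply/esum_nat_leP.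
Qed.

(** The recursion for w gives 1 - w n - (1 - t n) * w n.+1 = (1 - t n / 2) * (1 - w n.+1). Hence the
    factor 1 - t n / 2: the slack left in the simplex after the coordinates 0, ..., n is
    [scale t n * (1 - w n)]. *)
Fixpoint scale (t : nat -> R) (n : nat) : R :=
  if n is k.+1 then scale t k * (1 - t k / 2) else 1.

Lemma scale_gt0 t n : (forall k, 0 <= t k <= 1) -> 0 < scale t n <= 1.
Proof.
move=> t01; elim: n => [|n IH] /=; first by rewrite ltr01 lexx.
have := t01 n; move: IH; move: (scale t n) (t n) => c s.
move=> /andP[c0 c1] /andP[s0 s1]; apply/andP; split; nra.
Qed.

(* With w n = t n (1 + w n.+1) / 2, the pair (w n, cube_to_simplex t w n.+1 /
   scale t n) is the image of (t n, w n.+1) under the map from the square to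
   the triangle. *)
Definition cube_to_simplex (t w : nat -> R) (n : nat) : R :=
  if n is k.+1 then scale t k * ((1 - t k) * w k.+1) else w 0%N.

Lemma sum_cube_to_simplex t w N :
  (forall n, w n = t n * (1 + w n.+1) / 2) ->
  \sum_(i < N.+1) cube_to_simplex t w i = 1 - scale t N * (1 - w N).
Proof.
move=> rw; elim: N => [|N IH]; first by rewrite big_ord1 /=; ring.
by rewrite big_ord_recr /= IH [in LHS](rw N); field.
Qed.

(* A point of the compact graph carries t in [inl] and w in [inr]; both the
   projection to t and the map to the simplex are polynomial in the
   coordinates, so no continuity of infinite series is needed. *)
Definition cube_graph : set {ptws (nat + nat)%type -> R} :=
  [set x | (forall i, 0 <= x i <= 1) /\
    forall n, x (inr n) = x (inl n) * (1 + x (inr n.+1)) / 2].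

Lemma closed_cube_graph : closed cube_graph.
Proof.
apply: closedI; first exact: (@closed_cube R (nat + nat)%type).
apply: (closed_forall (A := fun n => [set x : {ptws (nat + nat)%type -> R} |
  x (inr n) = x (inl n) * (1 + x (inr n.+1)) / 2])) => n.
apply: closed_fun_eq; first exact: ptws_eval_continuous.
apply: continuous_mul; last exact: cst_continuous.
apply: continuous_mul; first exact: ptws_eval_continuous.
by apply: continuous_add; [exact: cst_continuous|exact: ptws_eval_continuous].
Qed.

Lemma cube_graph_le1 x : cube_graph x -> forall i, `|x i| <= 1.
Proof. by case=> x01 _ i; have /andP[x0 x1] := x01 i; rewrite ger0_norm. Qed.

(** The coefficients t n / 2 are at most 1/2, so their products vanish and t determines w. Existence
    of w uses the constant supersolution 1. *)
Lemma cube_graph_bij_cube :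
  set_bij cube_graph (cube R nat) (fun x n => x (inl n)).
Proof.
split.
- by move=> x [x01 _] n.
- move=> x y /set_mem[x01 rx] /set_mem[y01 ry] /funeqP xy.
  apply/funext => -[n|n]; first exact: (xy n).
  have e : (fun n => x (inr n)) =1 (fun n => y (inr n)).
    apply: (@affine_recursion_uniq R (fun n => x (inl n) / 2)
      (fun n => x (inl n) / 2) _ _ 1).
    + by move=> k; have := x01 (inl k); lra.
    + move=> k e e0; have [m _ /(_ _ (leqnn m)) me] : \forall m \near \oo, (2^-1 : R) ^+ m < e.
        have := @cvg_expr R 2^-1; rewrite ger0_norm ?invr_ge0// => /(_ _)/cvgr0Pnorm_lt.
        move=> /(_ ltac:(lra))/(_ e e0); apply: filterS => m.
        by rewrite ger0_norm// exprn_ge0// invr_ge0.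
      exists m; apply: le_trans (ltW me).
      rewrite -[X in _ ^+ X](card_ord m) -prodr_const.
      by apply: ler_prod => i _; have := x01 (inl (k + i)%N); lra.
    + by move=> k; have := x01 (inr k); rewrite ler_norml; lra.
    + by move=> k; have := y01 (inr k); rewrite ler_norml; lra.
    + by move=> k; rewrite rx; lra.
    + by move=> k; have /= := xy k; rewrite ry => ->; lra.
  exact: e.
- move=> t t01.
  have [||||w Hw] := @affine_recursion_ex R (fun n => t n / 2) (fun n => t n / 2)
    (fun=> 1).
  + by move=> n; have := t01 n; lra.
  + by move=> n; have := t01 n; lra.
  + by [].
  + by move=> n; have := t01 n; lra.
  exists (fun i => match i with inl n => t n | inr n => w n end) => //.
  split; first by case=> n; [exact: t01|have [] := Hw n].
  by move=> n; have [_ ->] := Hw n; lra.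
Qed.

Lemma cube_graph_bij_simplex :
  set_bij cube_graph (simplex R (unit * nat)%type)
    (fun x p => cube_to_simplex (fun n => x (inl n)) (fun n => x (inr n)) p.2).
Proof.
split.
- move=> x [x01 rx]; apply/simplex_unit_natP.
  have t01 k : 0 <= x (inl k) <= 1 by exact: x01.
  have z0 n : 0 <= cube_to_simplex (fun n => x (inl n)) (fun n => x (inr n)) n.
    case: n => [|n] /=; first by case/andP: (x01 (inr 0%N)).
    have /andP[c0 _] := scale_gt0 n t01.
    apply: mulr_ge0; first exact: ltW.
    by apply: mulr_ge0; [have := t01 n; lra|case/andP: (x01 (inr n.+1))].
  split => // -[|N]; first by rewrite big_ord0 ler01.
  rewrite sum_cube_to_simplex// gerBl.
  have /andP[c0 _] := scale_gt0 N t01.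
  by apply: mulr_ge0; [exact: ltW|have := x01 (inr N); lra].
- move=> x y /set_mem[x01 rx] /set_mem[y01 ry] xy.
  have {}xy n : cube_to_simplex (fun n => x (inl n)) (fun n => x (inr n)) n =
      cube_to_simplex (fun n => y (inl n)) (fun n => y (inr n)) n.
    by have /funeqP/(_ (tt, n)) := xy.
  (* Decoding runs forward: [scale] and w at n, with the next simplex coordinate, determine t n and
     w n.+1 by injectivity of the planar map. *)
  have H n : scale (fun n => x (inl n)) n = scale (fun n => y (inl n)) n /\
      x (inr n) = y (inr n) /\ (forall k, (k < n)%N -> x (inl k) = y (inl k)).
    elim: n => [|n [cxy [wxy txy]]]; first by split => //; split => //; exact: (xy 0%N).
    have /andP[c0 _] := @scale_gt0 (fun n => y (inl n)) n (fun k => y01 (inl k)).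
    have [||||||tt' ww'] := @square_to_triangle_inj R (x (inl n)) (x (inr n.+1)) (y (inl n)) (y (inr n.+1)) => //.
    + by rewrite -rx -ry.
    + have /= := xy n.+1; rewrite cxy => /mulfI; apply.
      by rewrite gt_eqF.
    split; first by rewrite /= cxy tt'.
    split => // k; rewrite ltnS leq_eqVlt => /orP[/eqP ->//|]; exact: txy.
  apply/funext => -[n|n]; last by have [_ []] := H n.
  by have [_ [_ /(_ n)]] := H n.+1; apply.
- move=> z /simplex_unit_natP[z0 z1].
  (* The inverse is made total, with junk value (0, 0) outside the triangle, so that the recursion
     can be defined before its invariant is known. *)
  have stepP (xv : R * R) : exists tw : R * R,
      0 <= xv.1 -> 0 <= xv.2 -> xv.1 + xv.2 <= 1 ->
      [/\ 0 <= tw.1 <= 1, 0 <= tw.2 <= 1, tw.1 * (1 + tw.2) / 2 = xv.1 &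
          (1 - tw.1) * tw.2 = xv.2].
    case: xv => u v /=.
    have [[u0 v0 uv]|N] := pselect ([/\ 0 <= u, 0 <= v & u + v <= 1]).
      have [t [w H]] := square_to_triangle_surj u0 v0 uv.
      by exists (t, w).
    by exists (0, 0) => u0 v0 uv; case: N.
  have [step {}stepP] := choice stepP.
  pose st := fix st n : R * R := if n is k.+1 then
    let tw := step ((st k).2, z (tt, k.+1) / (st k).1) in
    ((st k).1 * (1 - tw.1 / 2), tw.2) else (1, z (tt, 0%N)).
  pose t n := (step ((st n).2, z (tt, n.+1) / (st n).1)).1.
  pose w n := (st n).2.
  have stE n : (st n).1 = scale t n by elim: n => //= n IH; rewrite -/(t n) IH.
  have inv n : [/\ 0 < scale t n, 0 <= w n &
      scale t n * (1 - w n) = 1 - \sum_(i < n.+1) z (tt, val i)] /\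
    [/\ 0 <= t n <= 1, 0 <= w n.+1 <= 1, t n * (1 + w n.+1) / 2 = w n &
      (1 - t n) * w n.+1 = z (tt, n.+1) / scale t n].
    suff K k : [/\ 0 < scale t k, 0 <= w k &
        scale t k * (1 - w k) = 1 - \sum_(i < k.+1) z (tt, val i)] ->
        [/\ 0 <= t k <= 1, 0 <= w k.+1 <= 1, t k * (1 + w k.+1) / 2 = w k &
        (1 - t k) * w k.+1 = z (tt, k.+1) / scale t k].
      have A : [/\ 0 < scale t n, 0 <= w n &
        scale t n * (1 - w n) = 1 - \sum_(i < n.+1) z (tt, val i)].
        elim: n => [|n IH]; first by split; [exact: ltr01|exact: z0|rewrite big_ord1 mul1r].
        have [/andP[t0 t1] /andP[w0 w1] e1 e2] := K n IH.
        have [c0 _ e] := IH; split => //=.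
        - by apply: mulr_gt0 => //; lra.
        rewrite big_ord_recr /= opprD addrA -e.
        have -> : z (tt, n.+1) = scale t n * ((1 - t n) * w n.+1).
          by rewrite e2 mulrCA divff ?mulr1// gt_eqF.
        by rewrite -e1; field.
      by split => //; exact: K.
    move=> [c0 w0 e].
    have := stepP (w k, z (tt, k.+1) / scale t k) => /=.
    rewrite /t /w /= stE; apply => //.
    - by apply: divr_ge0 => //; exact: ltW.
    (* The pair lies in the triangle because the next coordinate of z fits into the remaining
       slack. *)
    - rewrite -/(w k) -lerBrDl ler_pdivrMr// mulrC e.
      by have := z1 k.+2; rewrite big_ord_recr /=; lra.
  exists (fun i => match i with inl n => t n | inr n => w n end).
    split; last by move=> n; have [_ []] := inv n.
    case=> n; first by have [_ []] := inv n.
    have [[c0 w0 e] _] := inv n; rewrite w0 /= -subr_ge0 -(pmulr_rge0 _ c0) e.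
    by rewrite subr_ge0.
  apply/funext => -[[] [|n]] //=.
  have [[c0 _ _] [_ _ _ ->]] := inv n.
  by rewrite mulrCA divff ?mulr1// gt_eqF.
Qed.

Lemma cube_simplex_homeomorphic :
  homeomorphic (cube R nat) (simplex R (unit * nat)%type).
Proof.
apply: (@homeomorphic_trans _ _ _ _ cube_graph).
  apply: homeomorphic_sym.
  apply: ptws_homeomorphic closed_cube_graph cube_graph_le1 _ cube_graph_bij_cube => n.
  exact/continuous_subspaceT/ptws_eval_continuous.
apply: ptws_homeomorphic closed_cube_graph cube_graph_le1 _ cube_graph_bij_simplex.
move=> [[] [|n]] /=; apply: continuous_subspaceT; first exact: ptws_eval_continuous.
apply: continuous_mul; last first.
  apply: continuous_mul; last exact: ptws_eval_continuous.
  by apply: continuous_sub; [exact: cst_continuous|exact: ptws_eval_continuous].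
elim: n => [|n IH] /=; first exact: cst_continuous.
apply: continuous_mul IH _; apply: continuous_sub; first exact: cst_continuous.
by apply: continuous_mul; [exact: ptws_eval_continuous|exact: cst_continuous].
Qed.

End hilbert_cube_simplex.

(** * The planar shear *)

Section divergent_blocks.
Context {R : realType}.

(** Written through the absolute value, so that continuity is inherited from the norm and identities
    are linear in x and |x|. *)
Definition ppart (x : R) := (`|x| + x) / 2.
Definition npart (x : R) := (`|x| - x) / 2.
Definition slope (a b x : R) := (x - a) / (b - a).

Lemma ppart_ge0 x : 0 <= ppart x.
Proof. by rewrite /ppart; have := ler_norm (- x); rewrite normrN; lra. Qed.

Lemma npart_ge0 x : 0 <= npart x.
Proof. by rewrite /npart; have := ler_norm x; lra. Qed.

Lemma slope_itv (a b x : R) : a < b -> a <= x <= b -> 0 <= slope a b x <= 1.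
Proof.
move=> ab /andP[ax xb]; rewrite /slope divr_ge0 ?ler_pdivrMr ?subr_gt0//; lra.
Qed.

(* The map (x, m) |-> (x^+ + lambda m, x^- + (1 - lambda) m), where lambda is
   the relative position of x in [a, b], preserves |x| + |m| and sends
   [a, b] x [0, oo) bijectively onto the quadrant: on each level set
   |x| + m = s the first component increases from 0 to s with x. *)
Lemma shear_inj (a b x m x' m' : R) : a <= 0 -> 0 < b ->
  a <= x <= b -> a <= x' <= b -> 0 <= m -> 0 <= m' ->
  ppart x + slope a b x * m = ppart x' + slope a b x' * m' ->
  npart x + (1 - slope a b x) * m = npart x' + (1 - slope a b x') * m' ->
  x = x' /\ m = m'.
Proof.
move=> a0 b0 hx hx' m0 m'0 e1 e2.
have D0 : 0 < b - a by lra.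
pose s := `|x| + m.
have sx' : s = `|x'| + m' by rewrite /s; move: e1 e2; rewrite /ppart /npart; lra.
have E (y : R) : (b - a) * (ppart y + slope a b y * (s - `|y|)) =
    (b - a) * ppart y + (s - `|y|) * (y - a).
  by rewrite /slope; field; lra.
have mono (y y' : R) : a <= y -> y' <= b -> `|y| <= s -> `|y'| <= s -> y < y' ->
    (b - a) * ppart y + (s - `|y|) * (y - a) <
    (b - a) * ppart y' + (s - `|y'|) * (y' - a).
  move=> ay y'b ys y's yy'; rewrite /ppart.
  have [y0|y0] := lerP 0 y; have [y'0|y'0] := lerP 0 y';
    rewrite ?(ger0_norm y0) ?(ltr0_norm y0) ?(ger0_norm y'0) ?(ltr0_norm y'0)
      in ys y's *.
  - have : 0 < (y' - y) * ((b - y') + (s - y)) by apply: mulr_gt0; lra.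
    by nra.
  - lra.
  - have h : (s + y) * (y - a) < (b - a) * y' + (s - y') * (y' - a).
      have h1 : (s + y) * (y - a) <= s * - a by apply: ler_pM; lra.
      have [y'p|y'z] := ltrP 0 y'; last first.
        have -> : y' = 0 by lra.
        have h2 : 0 <= (y - a) * - y by apply: mulr_ge0; lra.
        have h3 : 0 < s * - y by apply: mulr_gt0; lra.
        by nra.
      have : 0 < y' * (b + s - y') by apply: mulr_gt0; lra.
      by nra.
    by nra.
  - have h1 : 0 < (y' - y) * ((y - a) + (s + y')).
      by apply: mulr_gt0; lra.
    by nra.
have ex : (b - a) * ppart x + (s - `|x|) * (x - a) =
    (b - a) * ppart x' + (s - `|x'|) * (x' - a).
  rewrite -!E; congr (_ * _).
  have -> : s - `|x| = m by rewrite /s; lra.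
  by have -> : s - `|x'| = m' by rewrite sx'; lra.
have xs : `|x| <= s by rewrite /s; lra.
have x's : `|x'| <= s by rewrite sx'; lra.
case/andP: hx => ax xb; case/andP: hx' => ax' x'b.
have xx' : x = x'.
  case: (ltrgtP x x') => // lt.
    by have := mono _ _ ax x'b xs x's lt; rewrite ex ltxx.
  by have := mono _ _ ax' xb x's xs lt; rewrite ex ltxx.
by split => //; move: sx'; rewrite /s xx'; lra.
Qed.

Lemma shear_surj (a b M Y : R) : a <= 0 -> 0 < b -> 0 <= M -> 0 <= Y ->
  exists x m : R, [/\ a <= x <= b, 0 <= m, ppart x + slope a b x * m = M &
                      npart x + (1 - slope a b x) * m = Y].
Proof.
move=> a0 b0 M0 Y0.
have D0 : 0 < b - a by lra.
pose s := M + Y.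
suff [x xab [xs ex]] : exists2 x, a <= x <= b & `|x| <= s /\
    (b - a) * ppart x + (s - `|x|) * (x - a) = (b - a) * M.
  exists x, (s - `|x|).
  have eM : ppart x + slope a b x * (s - `|x|) = M.
    apply: (@mulfI _ (b - a)); first by rewrite gt_eqF.
    by rewrite -ex /slope; field; lra.
  split => //; first lra.
  by move: eM; rewrite /s /ppart /npart; lra.
(* The equation is quadratic on each side of 0. Its left side equals s * - a at x = 0, so this
   comparison decides the sign of the root. *)
have [h|h] := lerP (s * - a) ((b - a) * M).
  have [||x /andP[x0 xh] ex] := @quadratic_ivt R (-1) ((b - a) + s + a)
      (- s * a - (b - a) * M) 0 (Num.min b s).
  - by rewrite le_min /s; lra.
  - apply/andP; split; first lra.
    have [bs|sb] := lerP b s.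
      have : 0 <= (b - a) * Y by apply: mulr_ge0; lra.
      by rewrite /s; nra.
    have : 0 <= (b - a) * Y by apply: mulr_ge0; lra.
    by rewrite /s; nra.
  move: xh; rewrite le_min => /andP[xb xs].
  exists x; first by apply/andP; split => //; lra.
  by rewrite /ppart ger0_norm//; split => //; nra.
have [||x /andP[xl x0] ex] := @quadratic_ivt R 1 (s - a)
    (- s * a - (b - a) * M) (Num.max a (- s)) 0.
- by rewrite ge_max a0 /s; lra.
- apply/andP; split; last lra.
  have : 0 <= (b - a) * M by apply: mulr_ge0; lra.
  by have [sa|sa] := lerP a (- s); nra.
move: xl; rewrite ge_max => /andP[ax sx].
exists x; first by apply/andP; split => //; lra.
by rewrite /ppart ler0_norm//; split; nra.
Qed.

(** A quantitative form of the fact that a product vanishes when the sum of 1 - l diverges. With t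
    the new factor and S the previous sum, the induction step is (1 - t)^2 + S * (1 - t) >= 0. *)
Lemma prod_le_inv (l : nat -> R) k : (forall n, 0 <= l n <= 1) ->
  \prod_(i < k) l i * (1 + \sum_(i < k) (1 - l i)) <= 1.
Proof.
move=> l01; elim: k => [|k IH]; first by rewrite !big_ord0; lra.
rewrite !big_ord_recr /=; apply: le_trans IH.
have P0 : 0 <= \prod_(i < k) l i by apply: prodr_ge0 => i _; case/andP: (l01 i).
have S0 : 0 <= \sum_(i < k) (1 - l i).
  by apply: sumr_ge0 => i _; have := l01 i; lra.
have := l01 k; move: (l k) (\prod_(i < k) _) (\sum_(i < k) _) P0 S0.
move=> t P S P0 S0 /andP[t0 t1].
rewrite -mulrA ler_wpM2l//.
have : 0 <= (1 - t) ^+ 2 + S * (1 - t).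
  by apply: addr_ge0; [exact: sqr_ge0|apply: mulr_ge0; lra].
by nra.
Qed.

Lemma divergent_tail (u : nat -> R) (n : nat) (A : R) : (forall n, 0 <= u n) ->
  (\esum_(n in [set: nat]) (u n)%:E = +oo)%E ->
  exists k, A <= \sum_(i < k) u (n + i)%N.
Proof.
move=> u0 uoo; apply: contrapT => /forallNP H.
have : (\esum_(n in [set: nat]) (u n)%:E <= (\sum_(i < n) u i + A)%:E)%E.
  apply/esum_nat_leP => // N.
  have := H N; move/negP; rewrite -ltNge => HN.
  apply: (@le_trans _ _ (\sum_(i < n + N) u i)).
    by rewrite addnC big_split_ord /= lerDl; apply: sumr_ge0.
  by rewrite big_split_ord /= lerD2l ltW.
by rewrite uoo leye_eq.
Qed.

(** Since b - a <= 2 * C, each 1 - slope = (b - x) / (b - a) is at least (b - |x|) / (2 * C). The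
    sum of b diverges while that of |x| is at most 1, so the defects 1 - slope have infinite sum. *)
Lemma slope_prod_small (a b x : nat -> R) (C : R) :
  (forall n, - b n <= a n <= 0) -> (forall n, 0 < b n <= C) ->
  (\esum_(n in [set: nat]) (b n)%:E = +oo)%E ->
  (forall n, a n <= x n <= b n) -> (forall N, \sum_(i < N) `|x i| <= 1) ->
  forall n e, 0 < e ->
    exists k, \prod_(i < k) slope (a (n + i)%N) (b (n + i)%N) (x (n + i)%N) <= e.
Proof.
move=> ha hb boo hx x1 n e e0.
have C0 : 0 < C by have := hb 0%N; lra.
(* The extra 1 pays for the sum of |x|. *)
have [k hk] := @divergent_tail b n (2 * C * e^-1 + 1) (fun n => ltac:(have := hb n; lra)) boo.
exists k; clear boo.
pose l i := slope (a (n + i)%N) (b (n + i)%N) (x (n + i)%N).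
have l01 i : 0 <= l i <= 1.
  by apply: slope_itv; [have := ha (n + i)%N; have := hb (n + i)%N; lra|exact: hx].
have tx : \sum_(i < k) `|x (n + i)%N| <= 1.
  apply: le_trans (x1 (n + k)%N); rewrite big_split_ord /= lerDr.
  by apply: sumr_ge0.
have S1 : e^-1 <= \sum_(i < k) (1 - l i).
  rewrite -(ler_pM2l (_ : 0 < 2 * C)); last lra.
  apply: (@le_trans _ _ (\sum_(i < k) (b (n + i)%N - `|x (n + i)%N|))).
    by rewrite sumrB; lra.
  rewrite mulr_sumr; apply: ler_sum => i _.
  have := ha (n + i)%N; have := hb (n + i)%N; have := hx (n + i)%N.
  rewrite /l /slope; move: (a _) (b _) (x _) => a' b' x'.
  move=> /andP[ax xb] /andP[b0 bC] /andP[ba a0].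
  have -> : 1 - (x' - a') / (b' - a') = (b' - x') / (b' - a') by field; lra.
  rewrite mulrA ler_pdivlMr; last lra.
  have := ler_norm x' => hn.
  have [bx|bx] := lerP 0 (b' - `|x'|).
    rewrite mulrC; apply: ler_pM => //; lra.
  apply: (@le_trans _ _ 0); last by apply: mulr_ge0; lra.
  by rewrite nmulr_rle0//; lra.
have := prod_le_inv k l01.
have P0 : 0 <= \prod_(i < k) l i by apply: prodr_ge0 => i _; case/andP: (l01 i).
move=> h.
have : \prod_(i < k) l i * e^-1 <= 1.
  by apply: le_trans h; apply: ler_wpM2l => //; lra.
by rewrite ler_pdivrMr// mul1r.
Qed.

End divergent_blocks.

(** * Blocks with divergent bounds *)

Section block_chain.
Context {R : realType} (J : choiceType) (a b : J * nat -> R) (C : R).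
Hypothesis ha : forall p, - b p <= a p <= 0.
Hypothesis hb : forall p, 0 < b p <= C.
Hypothesis hinf :
  forall j, (\esum_(n in [set: nat]) (b (j, n))%:E = +oo)%E.

Let I := (J * nat)%type.
Let rate (x : I -> R) (p : I) : R := slope (a p) (b p) (x p).

Let ab p : a p < b p. Proof. by have := ha p; have := hb p; lra. Qed.

(* [inl] carries the point x of the ball and [inr] a reservoir m, which moves
   along each block by m n = x_n^+ + lambda_n m n.+1 and starts from 0 at
   infinity: since the b n are not summable while the `|x n| are, the products
   of the lambda_n vanish and x determines m. *)
Definition chain_graph : set {ptws (I + I)%type -> R} :=
  [set x | [/\ ball1_between a b (fun p => x (inl p)),
    (fun p => x (inr p)) \in cube R I &
    forall p, x (inr p) = ppart (x (inl p)) +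
      slope (a p) (b p) (x (inl p)) * x (inr (p.1, p.2.+1))]].

(** The shear at n turns (x n, m n.+1) into (m n, z n.+1): the first component is handed down to the
    next shear and the second is emitted. What arrives at the bottom, m 0, is emitted as z 0. *)
Definition chain_out (x m : I -> R) (p : I) : R :=
  if p.2 is n.+1 then npart (x (p.1, n)) + (1 - rate x (p.1, n)) * m p
  else m p.

Lemma continuous_slope (S : topologicalType) (c d : R) (f : S -> R) :
  continuous f -> continuous (fun x => slope c d (f x)).
Proof.
move=> cf; apply: continuous_mul; last exact: cst_continuous.
by apply: continuous_sub => //; exact: cst_continuous.
Qed.

Lemma continuous_ppart (S : topologicalType) (f : S -> R) :
  continuous f -> continuous (fun x => ppart (f x)).
Proof.
move=> cf; apply: continuous_mul; last exact: cst_continuous.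
by apply: continuous_add => //; exact: continuous_abs.
Qed.

Lemma continuous_npart (S : topologicalType) (f : S -> R) :
  continuous f -> continuous (fun x => npart (f x)).
Proof.
move=> cf; apply: continuous_mul; last exact: cst_continuous.
by apply: continuous_sub => //; exact: continuous_abs.
Qed.

Lemma closed_chain_graph : closed chain_graph.
Proof.
have cl : continuous (fun (x : {ptws (I + I)%type -> R}) =>
    (fun p => x (inl p)) : {ptws I -> R}).
  by apply: ptws_continuous => p; exact: ptws_eval_continuous.
have cr : continuous (fun (x : {ptws (I + I)%type -> R}) =>
    (fun p => x (inr p)) : {ptws I -> R}).
  by apply: ptws_continuous => p; exact: ptws_eval_continuous.
rewrite (_ : chain_graph =
    (fun x : {ptws (I + I)%type -> R} => (fun p => x (inl p)) : {ptws I -> R})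
      @^-1` ball1_between a b `&`
    ((fun x : {ptws (I + I)%type -> R} => (fun p => x (inr p)) : {ptws I -> R})
      @^-1` @cube R I `&`
    [set x | forall p, x (inr p) = ppart (x (inl p)) +
      slope (a p) (b p) (x (inl p)) * x (inr (p.1, p.2.+1))])); last first.
  apply/seteqP; split=> x; first by case=> h1 /set_mem h2 h3.
  by case=> h1 [h2 h3]; split => //; exact/mem_set.
apply: closedI.
  by apply: closed_comp (@closed_ball1_between _ _ _ _) => x _; exact: cl.
apply: closedI.
  by apply: closed_comp (@closed_cube _ _) => x _; exact: cr.
apply: (closed_forall (A := fun p : I => [set x : {ptws (I + I)%type -> R} |
  x (inr p) = ppart (x (inl p)) +
      slope (a p) (b p) (x (inl p)) * x (inr (p.1, p.2.+1))])) => p.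
apply: closed_fun_eq; first exact: ptws_eval_continuous.
apply: continuous_add; first exact/continuous_ppart/ptws_eval_continuous.
apply: continuous_mul; last exact: ptws_eval_continuous.
exact/continuous_slope/ptws_eval_continuous.
Qed.

Lemma chain_graph_le1 x : chain_graph x -> forall i, `|x i| <= 1.
Proof.
case=> xl /set_mem xr _ [p|p]; first exact: (ball1_between_le1 xl).
by have /andP[h0 h1] := xr p; rewrite ger0_norm.
Qed.

Lemma row_sum_le1 (x : I -> R) j N : ball1_between a b x ->
  \sum_(i < N) `|x (j, val i)| <= 1.
Proof.
move=> [x1 _]; rewrite -lee_fin; apply: le_trans x1.
apply: le_trans (@esum_row_le R J (fun p => `|x p|%:E) j _); last first.
  by move=> p; rewrite lee_fin.
exact: (@esum_nat_lb R (fun n => `|x (j, n)|)).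
Qed.

Lemma rate_prod_small (x : I -> R) j n e : ball1_between a b x -> 0 < e ->
  exists k, \prod_(i < k) rate x (j, (n + i)%N) <= e.
Proof.
move=> hx; apply: (@slope_prod_small R (fun n => a (j, n)) (fun n => b (j, n))
  (fun n => x (j, n)) C) => //; last by move=> N; exact: row_sum_le1.
by move=> k; have [_] := hx; apply.
Qed.

Lemma chain_graph_bij_ball :
  set_bij chain_graph (ball1_between a b) (fun x p => x (inl p)).
Proof.
split.
- by move=> x [].
- move=> x y /set_mem[xl /set_mem xr rx] /set_mem[yl /set_mem yr ry] /funeqP xy.
  apply/funext => -[p|p]; first exact: (xy p).
  case: p => j n.
  have e : (fun n => x (inr (j, n))) =1 (fun n => y (inr (j, n))).
    apply: (@affine_recursion_uniq R (fun n => ppart (x (inl (j, n))))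
      (fun n => rate (fun p => x (inl p)) (j, n)) _ _ 1).
    + by move=> k; have [_ xab] := xl; case/andP: (slope_itv (ab (j, k)) (xab (j, k))).
    + by move=> k e0; exact: rate_prod_small.
    + by move=> k; have /andP[h0 h1] := xr (j, k); rewrite ger0_norm.
    + by move=> k; have /andP[h0 h1] := yr (j, k); rewrite ger0_norm.
    + by move=> k; rewrite rx.
    + by move=> k; rewrite ry -(xy (j, k)).
  exact: e.
- move=> x hx; have [x1 xab] := hx.
  (* The mass not yet used by x is a supersolution, because x^+ <= |x| and the rates are at most 1;
     it keeps the reservoir below 1. *)
  have /choice[m Hm] : forall j, exists m : nat -> R,
      forall n, 0 <= m n <= 1 - \sum_(i < n) `|x (j, val i)| /\
        m n = ppart (x (j, n)) + rate x (j, n) * m n.+1.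
    move=> j; apply: affine_recursion_ex.
    + by move=> n; exact: ppart_ge0.
    + by move=> n; case/andP: (slope_itv (ab (j, n)) (xab (j, n))).
    + by move=> n; rewrite subr_ge0; exact: row_sum_le1.
    + move=> n; have /andP[r0 r1] := slope_itv (ab (j, n)) (xab (j, n)).
      have := row_sum_le1 j n.+1 hx; rewrite big_ord_recr /= => s1.
      have h : rate x (j, n) * (1 - (\sum_(i < n) `|x (j, val i)| + `|x (j, n)|)) <=
          1 - (\sum_(i < n) `|x (j, val i)| + `|x (j, n)|).
        by rewrite ler_piMl// subr_ge0.
      have := ler_norm (x (j, n)); rewrite /ppart => h'.
      by move: h; lra.
  exists (fun i => match i with inl p => x p | inr p => m p.1 p.2 end) => //.
  split => //.
    apply/mem_set => -[j n] /=; have [/andP[-> mB] _] := Hm j n.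
    by apply: (le_trans mB); rewrite gerBl; apply: sumr_ge0.
  by case=> j n /=; have [_] := Hm j n.
Qed.

(** Each shear preserves |x| + m, so the sum telescopes; z 0 accounts for the extra term on the
    left. *)
Lemma chain_out_sum (x m : I -> R) j N :
  (forall p, m p = ppart (x p) + rate x p * m (p.1, p.2.+1)) ->
  \sum_(i < N.+1) chain_out x m (j, val i) =
  \sum_(i < N) `|x (j, val i)| + m (j, N).
Proof.
move=> rm; elim: N => [|N IH]; first by rewrite big_ord1 big_ord0 add0r.
rewrite big_ord_recr IH [in RHS]big_ord_recr /= [in LHS](rm (j, N)) /=.
by rewrite /chain_out /= /ppart /npart; field.
Qed.

(** The recursion unrolled k times. As the product tends to 0, the reservoir at N holds no more than
    the tail of |x| from N on, so the output has no larger norm than x. *)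
Lemma chain_tail (x m : I -> R) j N k : ball1_between a b x -> cube R I m ->
  (forall p, m p = ppart (x p) + rate x p * m (p.1, p.2.+1)) ->
  m (j, N) <= \sum_(i < k) `|x (j, (N + i)%N)| +
    (\prod_(i < k) rate x (j, (N + i)%N)) * m (j, (N + k)%N).
Proof.
move=> [_ xab] m01 rm.
have r01 p : 0 <= rate x p <= 1 by apply: slope_itv.
elim: k => [|k IH]; first by rewrite !big_ord0 addn0; lra.
apply: (le_trans IH); rewrite !big_ord_recr /= [X in _ + _ * X <= _]rm /= -addnS.
have P1 : 0 <= \prod_(i < k) rate x (j, (N + i)%N) <= 1.
  apply/andP; split; last by apply: prodr_ile1 => i _; exact: r01.
  by apply: prodr_ge0 => i _; case/andP: (r01 (j, (N + i)%N)).
have := ler_norm (x (j, (N + k)%N)).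
move: (\prod_(i < k) _) P1 => P /andP[P0 P1] hx.
have : P * ppart (x (j, (N + k)%N)) <= 1 * `|x (j, (N + k)%N)|.
  by apply: ler_pM => //; [exact: ppart_ge0|rewrite /ppart; lra].
by rewrite /=; lra.
Qed.

(** Norms are compared row by row, and [esum_pair] adds up the rows. Decoding starts from m (j, 0) =
    z (j, 0) and inverts one shear at a time; partial sums of z then bound both the partial sums of
    |x| and the reservoir. *)
Lemma chain_graph_bij_simplex :
  set_bij chain_graph (simplex R I)
    (fun x => chain_out (fun p => x (inl p)) (fun p => x (inr p))).
Proof.
split.
- move=> x [xl /set_mem xr rx]; have [x1 xab] := xl.
  set y := (fun p => x (inl p)) in xl x1 xab *.
  set m := (fun p => x (inr p)) in xr *.
  have rm p : m p = ppart (y p) + rate y p * m (p.1, p.2.+1) by exact: rx.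
  have z0 p : 0 <= chain_out y m p.
    case: p => j [|n]; rewrite /chain_out /=; first by case/andP: (xr (j, 0%N)).
    have /andP[r0 r1] := slope_itv (ab (j, n)) (xab (j, n)).
    apply: addr_ge0; first exact: npart_ge0.
    by apply: mulr_ge0; [rewrite subr_ge0|case/andP: (xr (j, n.+1))].
  split => //; apply: le_trans x1.
  rewrite !esum_pair; [|by move=> p; rewrite lee_fin..].
  apply: le_esum => j _.
  apply: (@esum_nat_le R (fun n => chain_out y m (j, n)) (fun n => `|y (j, n)|)) => //.
  move=> [|N] e e0; first by exists 0%N; rewrite !big_ord0; lra.
  have [k hk] := rate_prod_small j N xl e0.
  exists (N + k)%N; rewrite (chain_out_sum j N rm) big_split_ord /= -addrA lerD2l.
  apply: (le_trans (@chain_tail y m j N k xl xr rm)); rewrite lerD2l.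
  have /andP[m0 m1] := xr (j, (N + k)%N).
  apply: le_trans hk; apply: ler_piMr => //.
  by apply: prodr_ge0 => i _; case/andP: (slope_itv (ab (j, (N + i)%N)) (xab (j, (N + i)%N))).
- move=> x y /set_mem[xl /set_mem xr rx] /set_mem[yl /set_mem yr ry] /funeqP xy.
  have [_ xab] := xl; have [_ yab] := yl.
  have H j n : x (inr (j, n)) = y (inr (j, n)) /\
      (forall k, (k < n)%N -> x (inl (j, k)) = y (inl (j, k))).
    elim: n => [|n [mxy txy]]; first by split => //; exact: (xy (j, 0%N)).
    have [||||||||e1 e2] := @shear_inj R (a (j, n)) (b (j, n)) (x (inl (j, n)))
      (x (inr (j, n.+1))) (y (inl (j, n))) (y (inr (j, n.+1))).
    + by have := ha (j, n); lra.
    + by have := hb (j, n); lra.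
    + exact: (xab (j, n)).
    + exact: (yab (j, n)).
    + by case/andP: (xr (j, n.+1)).
    + by case/andP: (yr (j, n.+1)).
    + by have := rx (j, n); have := ry (j, n) => /= <- <-.
    + exact: (xy (j, n.+1)).
    split => // k; rewrite ltnS leq_eqVlt => /orP[/eqP ->//|]; exact: txy.
  apply/funext => -[[j n]|[j n]]; last by have [] := H j n.
  by have [_ /(_ n)] := H j n.+1; apply.
- move=> z [z1 z0].
  have stepP (q : I * (R * R)) : exists xm : R * R,
      0 <= q.2.1 -> 0 <= q.2.2 ->
      [/\ a q.1 <= xm.1 <= b q.1, 0 <= xm.2,
        ppart xm.1 + slope (a q.1) (b q.1) xm.1 * xm.2 = q.2.1 &
        npart xm.1 + (1 - slope (a q.1) (b q.1) xm.1) * xm.2 = q.2.2].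
    case: q => p [u v] /=.
    have [[u0 v0]|N] := pselect (0 <= u /\ 0 <= v); last first.
      by exists (0, 0) => u0 v0; case: N.
    have [||x [m H]] := @shear_surj R (a p) (b p) u v _ _ u0 v0.
    + by have := ha p; lra.
    + by have := hb p; lra.
    by exists (x, m).
  have [step {}stepP] := choice stepP.
  pose ms := fix ms j n : R := if n is k.+1 then
    (step ((j, k), (ms j k, z (j, k.+1)))).2 else z (j, 0%N).
  pose m (p : I) := ms p.1 p.2.
  pose x (p : I) := (step (p, (m p, z (p.1, p.2.+1)))).1.
  have m0 p : 0 <= m p.
    case: p => j; elim => [|n IH]; first exact: z0.
    by have [] := stepP ((j, n), (m (j, n), z (j, n.+1))) IH (z0 _).
  have H p : [/\ a p <= x p <= b p,
      ppart (x p) + rate x p * m (p.1, p.2.+1) = m p &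
      npart (x p) + (1 - rate x p) * m (p.1, p.2.+1) = z (p.1, p.2.+1)].
    by case: p => j n; have [] := stepP ((j, n), (m (j, n), z (j, n.+1))) (m0 _) (z0 _).
  have rm p : m p = ppart (x p) + rate x p * m (p.1, p.2.+1) by have [_ ->] := H p.
  have out : chain_out x m = z.
    by apply/funext => -[j [|n]] //; have [_ _ <-] := H (j, n).
  have sums j N : \sum_(i < N) `|x (j, val i)| + m (j, N) =
      \sum_(i < N.+1) z (j, val i) by rewrite -(chain_out_sum j N rm) out.
  have xl : ball1_between a b x.
    split; last by move=> p; have [] := H p.
    apply: le_trans z1; rewrite !esum_pair; [|by move=> p; rewrite lee_fin..].
    apply: le_esum => j _.
    apply: (@esum_nat_le R (fun n => `|x (j, n)|) (fun n => z (j, n))) => // N e e0.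
    by exists N.+1; rewrite -sums; have := m0 (j, N); lra.
  exists (fun i => match i with inl p => x p | inr p => m p end) => //.
  split => //; apply/mem_set => -[j n]; rewrite m0 /=.
  have : \sum_(i < n.+1) z (j, val i) <= 1.
    rewrite -lee_fin; apply: le_trans z1.
    apply: le_trans (@esum_row_le R J (fun p => (z p)%:E) j _); last first.
      by move=> p; rewrite lee_fin.
    exact: (@esum_nat_lb R (fun n => z (j, n))).
  rewrite -sums; apply: le_trans; rewrite lerDr.
  by apply: sumr_ge0.
Qed.

Lemma divergent_ball_simplex :
  homeomorphic (ball1_between a b) (simplex R I).
Proof.
apply: (@homeomorphic_trans _ _ _ _ chain_graph).
  apply: homeomorphic_sym.
  apply: ptws_homeomorphic closed_chain_graph chain_graph_le1 _ chain_graph_bij_ball => p.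
  exact/continuous_subspaceT/ptws_eval_continuous.
apply: ptws_homeomorphic closed_chain_graph chain_graph_le1 _ chain_graph_bij_simplex.
case=> j [|n]; apply: continuous_subspaceT; first exact: ptws_eval_continuous.
apply: continuous_add; first exact/continuous_npart/ptws_eval_continuous.
apply: continuous_mul; last exact: ptws_eval_continuous.
apply: continuous_sub; first exact: cst_continuous.
exact/continuous_slope/ptws_eval_continuous.
Qed.

End block_chain.

(** * Partition into divergent blocks *)

Section block_decomposition.
Context {R : realType}.

Lemma esum_subset (I : choiceType) (A B : set I) (f : I -> \bar R) :
  A `<=` B -> (\esum_(i in A) f i <= \esum_(i in B) f i)%E.
Proof.
move=> AB; apply: ereal_sup_le => _ [X [finX XA] <-].
by exists X => //; split => //; exact: subset_trans AB.
Qed.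

Lemma esum_infinite_lb (I : choiceType) (A : set I) (f : I -> R) (c : R) :
  0 < c -> infinite_set A -> (forall i, A i -> c <= f i) ->
  (\esum_(i in A) (f i)%:E = +oo)%E.
Proof.
move=> c0 infA cf; apply/eqyP => M M0.
have [X XA sX] := infinite_set_fset (Num.truncn (M / c)).+1 infA.
apply: esum_ge; exists [set` X]; first by split; [exact: finite_fset|].
rewrite fsbig_finite//= set_fsetK sumEFin lee_fin.
apply: (@le_trans _ _ (\sum_(i <- X) c)).
  rewrite big_const_seq count_predT iter_addr_0 -mulr_natr mulrC -ler_pdivrMr//.
  apply: ltW; apply: lt_le_trans (truncnS_gt _) _.
  by rewrite ler_nat.
rewrite big_seq [leRHS]big_seq; apply: ler_sum => i iX.
by apply/cf/XA.
Qed.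

Lemma countable_infinite_subset (I : Type) (A : set I) : infinite_set A ->
  exists X : set I, [/\ X `<=` A, countable X & infinite_set X].
Proof.
move/infiniteP/card_leP => [f].
pose g (n : nat) : I := val (f (SigSub (mem_set (Logic.I : setT n)))).
have ginj : injective g.
  move=> m n /val_inj/(@inj _ _ _ f); rewrite !inE => /(_ Logic.I Logic.I).
  by move/(congr1 val).
exists (range g); split.
- by move=> _ [n _ <-]; exact: set_valP.
- exact: card_image_le.
- have /card_eqPle[_ h] : (range g #= [set: nat])%card.
    by apply: inj_card_eq => m n _ _; exact: ginj.
  exact/infiniteP.
Qed.

Lemma countable_level_sets (I : Type) (A : set I) (f : I -> R) :
  (forall i, A i -> 0 < f i) ->
  (forall c, 0 < c -> finite_set [set i | A i /\ c <= f i]) -> countable A.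
Proof.
move=> f0 fin.
have -> : A = \bigcup_(n in [set: nat]) [set i | A i /\ n.+1%:R^-1 <= f i].
  apply/seteqP; split => [i Ai|i [n _ []]//].
  exists (Num.truncn (f i)^-1) => //; split => //.
  rewrite invf_ple ?posrE ?ltr0n ?f0//.
  exact/ltW/truncnS_gt.
apply: bigcup_countable => // n _; apply: finite_set_countable.
by apply: fin; rewrite invr_gt0.
Qed.

Lemma esum_lty_countable (I : choiceType) (f : I -> R) : (forall i, 0 < f i) ->
  (\esum_(i in [set: I]) (f i)%:E < +oo)%E -> countable [set: I].
Proof.
move=> f0 foo; apply: (@countable_level_sets _ _ f) => // c c0.
apply: contrapT => infA; move: foo; rewrite ltey => /negP; apply.
rewrite eq_le leey /=.
rewrite -(esum_infinite_lb c0 infA (fun i => @proj2 _ _)).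
exact: esum_subset.
Qed.

Definition divergent (K : choiceType) (w : K -> R) (X : set K) :=
  countable X /\ (\esum_(i in X) (w i)%:E = +oo)%E.

Lemma divergent_enum (K : choiceType) (w : K -> R) (X : set K) : (forall i, 0 <= w i) ->
  divergent w X -> exists g : nat -> K, set_bij [set: nat] X g /\
    (\esum_(n in [set: nat]) (w (g n))%:E = +oo)%E.
Proof.
move=> w0 [cX Xoo].
have infX : infinite_set X.
  move=> finX; move: Xoo; rewrite esum_fset//; last by move=> i _; rewrite lee_fin.
  by rewrite fsbig_finite//= sumEFin.
have := eq_card_nat cX infX; rewrite card_eq_sym => /card_bijP[f fbij].
pose g (n : nat) : K := val (f (SigSub (mem_set (Logic.I : setT n)))).
have gbij : set_bij [set: nat] X g.
  split.
  - by move=> n _; exact: set_valP.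
  - move=> m n _ _ /val_inj/(bij_inj fbij).
    by move/(congr1 val).
  - move=> i Xi; have [h fh hf] := fbij.
    exists (val (h (SigSub (mem_set Xi)))) => //.
    rewrite /g (_ : SigSub _ = h (SigSub (mem_set Xi))) ?hf//.
    exact: val_inj.
exists g; split => //.
by rewrite -Xoo (reindex_esum setT X g).
Qed.

(** A maximal disjoint family F of divergent sets leaves a set L without divergent subsets. If F is
    empty, L is everything and has finite sum; otherwise a single block can absorb L. *)
Lemma block_decomposition (K : choiceType) (w : K -> R) : (forall i, 0 < w i) ->
  (\esum_(i in [set: K]) (w i)%:E < +oo)%E \/
  exists (J : choiceType) (e : J * nat -> K), set_bij setT setT e /\
    forall j, (\esum_(n in [set: nat]) (w (e (j, n)))%:E = +oo)%E.
Proof.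
move=> w0.
have w0' i : 0 <= w i by exact: ltW.
pose P (F : set (set K)) := F `<=` divergent w /\
  forall X Y, F X -> F Y -> X `&` Y !=set0 -> X = Y.
have [|F [[Fdiv Fdisj] Fmax]] := @Zorn_bigcup _ P.
  move=> G GP totG; split.
    by move=> X [F GF FX]; have [+ _] := GP _ GF; apply.
  move=> X Y [F GF FX] [F' GF' FY].
  have [FF'|F'F] := totG _ _ GF GF'.
    by have [_] := GP _ GF'; apply => //; exact: FF'.
  by have [_] := GP _ GF; apply => //; exact: F'F.
pose L := ~` \bigcup_(X in F) X.
have noL X : X `<=` L -> ~ divergent w X.
  move=> XL Xdiv.
  have X0 : X !=set0.
    apply/set0P/eqP => X0; have [_] := Xdiv.
    by rewrite X0 esum_set0.
  have FX : ~ F X.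
    by case: X0 => i Xi FX; apply: (XL i Xi); exists X.
  apply: (Fmax (F `|` [set X])).
    split; first exact: subsetUl.
    by move=> /(_ X (or_intror erefl)).
  split; first by move=> Y [/Fdiv//|->].
  move=> Y Z [FY|->] [FZ|->] // [i [Yi Zi]].
  - by apply: Fdisj => //; exists i.
  - by case: (XL i Zi); exists Y.
  - by case: (XL i Yi); exists Z.
(* If some level set w >= c in L were infinite, a countable infinite part of it would be
   divergent. *)
have cL : countable L.
  apply: (@countable_level_sets _ _ w) => // c c0.
  apply: contrapT => /countable_infinite_subset[X [XL cX infX]].
  apply: (noL X); first by move=> i /XL[].
  split => //; apply: (esum_infinite_lb c0) => //.
  by move=> i /XL[].
have [F0|/set0P[X0 FX0]] := eqVneq F set0.
  left; rewrite ltey; apply/negP => /eqP Loo.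
  apply: (noL setT).
    by move=> i _ [X]; rewrite F0.
  split => //; suff <- : L = setT by [].
  by apply/seteqP; split => // i _ [X]; rewrite F0.
right.
(* Adding the countable set L to X0 preserves both countability and divergence. *)
pose B (X : set K) : set K := [set i | X i \/ X = X0 /\ L i].
have Bdiv (X : F) : divergent w (B (val X)).
  have FX : F (val X) by exact: set_valP.
  have [cX Xoo] := Fdiv _ FX; split.
    apply: (@sub_countable _ _ _ (\bigcup_(n in [set: nat]) (if n is 0%N then val X else L))).
      apply: subset_card_le => i [Xi|[_ Li]]; first by exists 0%N.
      by exists 1%N.
    by apply: bigcup_countable => // -[|n] _.
  apply/eqP; rewrite eq_le leey -Xoo; apply: esum_subset => i Xi.
  by left.
have /choice[g Hg] : forall X : F, exists g : nat -> K, set_bij [set: nat] (B (val X)) g /\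
    (\esum_(n in [set: nat]) (w (g n))%:E = +oo)%E.
  by move=> X; apply: divergent_enum.
exists (F : choiceType), (fun p => g p.1 p.2); split; last by move=> X; have [] := Hg X.
split => //.
- move=> [X m] [Y n] _ _ /= eg.
  have [[gX gXi _] _] := Hg X; have [[gY _ _] _] := Hg Y.
  have BX := gX m Logic.I; have BY := gY n Logic.I; rewrite /= -eg in BY.
  have FX : F (val X) by exact: set_valP.
  have FY : F (val Y) by exact: set_valP.
  have XY : X = Y.
    apply: val_inj; case: BX => [Xi|[XX0 Li]]; case: BY => [Yi|[YX0 Li']].
    + by apply: Fdisj => //; exists (g X m).
    + by case: Li'; exists (val X).
    + by case: Li; exists (val Y).
    + by rewrite XX0.
  subst Y; congr (_, _).
  by apply: gXi => //; rewrite in_setT.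
- move=> i _.
  have [X FX BXi] : exists2 X, F X & B X i.
    have [Li|/contrapT[X FX Xi]] := pselect (L i); first by exists X0 => //; right.
    by exists X => //; left.
  have [[_ _ gs] _] := Hg (SigSub (mem_set FX)).
  have [n _ gn] := gs i BXi.
  by exists (SigSub (mem_set FX), n).
Qed.

End block_decomposition.

(** * Summable bounds *)

Section summable_box.
Context {R : realType}.

Lemma esum_seq_split (I : choiceType) (s : seq I) (f : I -> R) :
  uniq s -> (forall i, 0 <= f i) ->
  (\esum_(i in [set: I]) (f i)%:E =
   (\sum_(i <- s) f i)%:E + \esum_(i in ~` [set` s]) (f i)%:E)%E.
Proof.
move=> us f0; rewrite (esumID [set` s]); last by move=> i _; rewrite lee_fin.
rewrite !setTI esum_fset; [|exact: finite_seq|by move=> i _; rewrite lee_fin].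
by rewrite -fsbig_seq//= sumEFin.
Qed.

(** If every finite set left more than e outside, all finite sums would be at most the total minus
    e. *)
Lemma esum_small_tail (I : choiceType) (f : I -> R) (e : R) :
  (forall i, 0 <= f i) -> (\esum_(i in [set: I]) (f i)%:E < +oo)%E -> 0 < e ->
  exists2 s : seq I, uniq s & (\esum_(i in ~` [set` s]) (f i)%:E <= e%:E)%E.
Proof.
move=> f0 foo e0.
have fE := esum_fin_num f0 foo; set M := fine _ in fE.
apply: contrapT => /forall2NP H.
have : (\esum_(i in [set: I]) (f i)%:E <= (M - e)%:E)%E.
  apply/(esum_leP _ f0) => s us.
  case: (H s) => // /negP; rewrite -ltNge => He.
  have := esum_seq_split us f0; rewrite fE.
  move: He; case: (\esum_(i in ~` _) _)%E => [r| |]//=.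
  by rewrite lte_fin -EFinD => er [Mr]; lra.
by rewrite fE lee_fin; lra.
Qed.

(** The Weierstrass M-test: outside a finite set the series is uniformly at most e / 2. *)
Lemma continuous_dominated_esum (S : topologicalType) (I : choiceType)
    (D : set I) (f : I -> S -> R) (u : I -> R) :
  (forall i, continuous (f i)) -> (forall i x, 0 <= f i x <= u i) ->
  (\esum_(i in [set: I]) (u i)%:E < +oo)%E ->
  continuous (fun x => fine (\esum_(i in D) (f i x)%:E)).
Proof.
move=> cf fu uoo x0.
have fx0 i x : 0 <= f i x by case/andP: (fu i x).
have u0 i : 0 <= u i by case/andP: (fu i x0) => h; exact: le_trans.
pose h i x := if i \in D then f i x else 0.
have ch i : continuous (h i).
  rewrite /h; case: (i \in D); first exact: cf.
  exact: cst_continuous.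
have h0 i x : 0 <= h i x by rewrite /h; case: ifP.
have hu i x : h i x <= u i by rewrite /h; case: ifP => // _; case/andP: (fu i x).
have hE x : (\esum_(i in D) (f i x)%:E = \esum_(i in [set: I]) (h i x)%:E)%E.
  rewrite esum_mkcond; apply: eq_esum => i _; rewrite /h.
  by case: ifP.
have hoo x : (\esum_(i in [set: I]) (h i x)%:E < +oo)%E.
  by apply: le_lt_trans uoo; apply: le_esum => i _; rewrite lee_fin.
under eq_fun do rewrite hE.
apply/cvgrPdist_le => e e0.
have [s us hs] := esum_small_tail u0 uoo (divr_gt0 e0 (ltr0n _ 2)).
have E x : exists2 r, 0 <= r <= e / 2 &
    fine (\esum_(i in [set: I]) (h i x)%:E) = \sum_(i <- s) h i x + r.
  have := esum_seq_split us (fun i => h0 i x).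
  have : (0 <= \esum_(i in ~` [set` s]) (h i x)%:E <= (e / 2)%:E)%E.
    rewrite esum_ge0/=; last by move=> i _; rewrite lee_fin.
    by apply: le_trans hs; apply: le_esum => i _; rewrite lee_fin.
  case: (\esum_(i in ~` _) _)%E => [r| |]; last 2 first.
  - by rewrite leye_eq andbF.
  - by rewrite leeNy_eq.
  by rewrite !lee_fin => r0 ->; exists r.
have /cvgrPdist_le/(_ (e / 2) (divr_gt0 e0 (ltr0n _ 2))) :=
  @continuous_sum_seq R S I h s ch x0.
apply: filterS => x.
have [r /andP[r0 re] ->] := E x; have [r' /andP[r'0 r'e] ->] := E x0.
by rewrite !ler_norml => /andP[h1 h2]; apply/andP; split; lra.
Qed.

Lemma continuous_at_mul (S : topologicalType) (f g : S -> R) (x : S) :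
  {for x, continuous f} -> {for x, continuous g} ->
  {for x, continuous (fun y => f y * g y)}.
Proof. exact: cvgM. Qed.

Lemma continuous_at_inv (S : topologicalType) (f : S -> R) (x : S) :
  f x != 0 -> {for x, continuous f} -> {for x, continuous (fun y => (f y)^-1)}.
Proof. exact: cvgV. Qed.

Lemma continuous_at_squeeze0 (S : topologicalType) (f g : S -> R) (x : S) :
  (forall y, `|f y| <= `|g y|) -> g x = 0 ->
  {for x, continuous g} -> {for x, continuous f}.
Proof.
move=> fg gx0 cg.
have fx0 : f x = 0 by apply/eqP; have := fg x; rewrite gx0 normr0 normr_le0.
apply/cvgrPdist_le => e e0.
have /cvgrPdist_le/(_ e e0) := cg.
apply: filterS => y; rewrite fx0 gx0 !sub0r !normrN.
exact: le_trans.
Qed.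

Lemma continuous_bigmax_seq (S : topologicalType) (I : Type) (f : I -> S -> R)
    (s : seq I) : (forall i, continuous (f i)) ->
  continuous (fun x => \big[Num.max/0]_(i <- s) f i x).
Proof.
move=> cf; elim: s => [|i s IH] x.
  under eq_fun do rewrite big_nil.
  exact: cvg_cst.
under eq_fun do rewrite big_cons.
apply: (@continuous_max _ _ (f i)); first exact: cf.
exact: IH.
Qed.

Section radial.
Variables (K : choiceType) (a b : K -> R) (s : seq K).
Hypothesis ha : forall i, - b i <= a i <= 0.
Hypothesis hb : forall i, 0 < b i.
Hypothesis hsum : (\esum_(i in [set: K]) (b i)%:E < +oo)%E.
Hypothesis us : uniq s.
Hypothesis hs : (\esum_(i in ~` [set` s]) (b i)%:E <= (2^-1)%:E)%E.

(** Clamping changes nothing on the box, but makes [tail] finite and continuous on the whole product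
    space. *)
Definition clamp (i : K) (t : R) : R := Num.max (a i) (Num.min (b i) t).
Definition tail (y : K -> R) : R :=
  fine (\esum_(i in ~` [set` s]) `|clamp i (y i)|%:E).
Definition head (y : K -> R) : R := \sum_(i <- s) `|y i|.
(* Minkowski functional of the box in the coordinates of s, for y in the cone
   spanned by the box; if a i = 0, the term y i / a i is 0. *)
Definition gauge (y : K -> R) : R :=
  \big[Num.max/0]_(i <- s) Num.max (y i / b i) (y i / a i).
(** On the ray through a nonzero head, with the tail fixed, the box ends at the multiple 1 / gauge
    and the ball at (1 - tail) / head. The ratio is the smaller of these divided by the first. As
    tail <= 1/2, it is positive on box points with nonzero head. *)
Definition ratio (y : K -> R) : R := Num.min 1 ((1 - tail y) * gauge y / head y).
Definition dilate (c : R) (y : K -> R) (i : K) : R :=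
  if i \in s then c * y i else y i.

Lemma clamp_le i t : `|clamp i t| <= b i.
Proof.
rewrite /clamp; have := ha i; have := hb i => b0 /andP[ba a0].
rewrite ler_norml; apply/andP; split; first by rewrite le_max ba.
by rewrite ge_max ge_min lexx/= andbT; lra.
Qed.

Lemma clamp_id i t : a i <= t <= b i -> clamp i t = t.
Proof. by case/andP=> at_ tb; rewrite /clamp min_r// max_r. Qed.

Lemma tailE y : (\esum_(i in ~` [set` s]) `|clamp i (y i)|%:E)%E = (tail y)%:E.
Proof.
rewrite /tail -(@esum_fin_num _ _ _ (fun i => `|clamp i (y i)|))//.
apply: (@le_lt_trans _ _ (2^-1)%:E); last exact: ltry.
by apply: le_trans hs; apply: le_esum => i _; rewrite lee_fin clamp_le.
Qed.

Lemma tail_itv y : 0 <= tail y <= 2^-1.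
Proof.
rewrite -!lee_fin -tailE; apply/andP; split.
  by apply: esum_ge0 => i _; rewrite lee_fin.
by apply: le_trans hs; apply: le_esum => i _; rewrite lee_fin clamp_le.
Qed.

Lemma esum_head_tail y : box a b y ->
  (\esum_(i in [set: K]) `|y i|%:E = (head y + tail y)%:E)%E.
Proof.
move=> hy; rewrite (esum_seq_split (f := fun i => `|y i|) us)// EFinD -tailE.
by congr (_ + _)%E; apply: eq_esum => i _; rewrite clamp_id.
Qed.

Lemma tail_dilate (c : R) y : tail (dilate c y) = tail y.
Proof.
rewrite /tail; congr fine; apply: eq_esum => i /= /negP.
by rewrite /dilate => /negbTE ->.
Qed.

Lemma head_dilate (c : R) y : 0 <= c -> head (dilate c y) = c * head y.
Proof.
move=> c0; rewrite /head mulr_sumr; apply: eq_big_seq => i is_.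
by rewrite /dilate is_ normrM ger0_norm.
Qed.

Lemma gauge_dilate (c : R) y : 0 <= c -> gauge (dilate c y) = c * gauge y.
Proof.
move=> c0; rewrite /gauge.
rewrite (big_morph (fun t => c * t) (id1 := 0) (op1 := Num.max)); last exact: mulr0.
  by apply: eq_big_seq => i is_; rewrite /dilate is_ maxr_pMr//; rewrite !mulrA.
by move=> u v; rewrite maxr_pMr.
Qed.

Lemma ratio_dilate c y : 0 < c -> ratio (dilate c y) = ratio y.
Proof.
move=> c0; rewrite /ratio tail_dilate head_dilate ?gauge_dilate//; [|exact: ltW..].
congr Num.min.
by rewrite mulrCA -mulf_div divff ?mul1r// gt_eqF.
Qed.

Lemma dilateM c d y : dilate c (dilate d y) = dilate (c * d) y.
Proof. by apply/funext => i; rewrite /dilate; case: (i \in s); rewrite ?mulrA. Qed.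

Lemma dilate1 y : dilate 1 y = y.
Proof. by apply/funext => i; rewrite /dilate mul1r if_same. Qed.

Lemma head_ge0 y : 0 <= head y.
Proof. exact: sumr_ge0. Qed.

Lemma head0 y : head y = 0 -> forall i, i \in s -> y i = 0.
Proof.
move=> /eqP; rewrite /head psumr_eq0 => [|i _]; last by [].
by move=> /allP H i /H /=; rewrite normr_eq0 => /eqP.
Qed.

Lemma dilate_head0 c y : head y = 0 -> dilate c y = y.
Proof.
move=> h; apply/funext => i; rewrite /dilate; case: ifP => // is_.
by rewrite (head0 h is_) mulr0.
Qed.

Lemma gauge_ge0 y : 0 <= gauge y.
Proof. exact: bigmax_ge_id. Qed.

Lemma gauge_ge y i : i \in s -> Num.max (y i / b i) (y i / a i) <= gauge y.
Proof.
by move=> is_; rewrite /gauge; apply: (@Order.TotalTheory.bigmax_sup_seq _ R K s 0 i xpredT _ _ is_).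
Qed.

Lemma gauge_le1 y : box a b y -> gauge y <= 1.
Proof.
move=> hy; apply: bigmax_le => // i _.
have /andP[ay yb] := hy i; have := hb i; have /andP[_ a0] := ha i => b0.
rewrite ge_max ler_pdivrMr// mul1r yb /=.
move: a0; rewrite [X in is_true X -> _]le_eqVlt => /orP[/eqP->|a0]; first by rewrite invr0 mulr0.
by rewrite ler_ndivrMr// mul1r.
Qed.

Lemma gauge_gt0 y : box a b y -> 0 < head y -> 0 < gauge y.
Proof.
move=> hy h0; rewrite lt0r gauge_ge0 andbT; apply/eqP => g0.
move: h0; rewrite lt0r => /andP[/eqP + _]; apply.
rewrite /head big_seq big1// => i is_.
have := gauge_ge y is_; rewrite g0 ge_max => /andP[yb ya].
have /andP[ay yb'] := hy i; have b0 := hb i; have /andP[ba a0] := ha i.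
apply/eqP; rewrite normr_eq0 eq_le; apply/andP; split.
  by move: yb; rewrite ler_pdivrMr// mul0r.
move: a0; rewrite [X in is_true X -> _]le_eqVlt => /orP[/eqP a0|a0]; first by rewrite -a0.
by move: ya; rewrite ler_ndivrMr// mul0r.
Qed.

Lemma ratio_itv y : 0 <= ratio y <= 1.
Proof.
rewrite /ratio le_min ler01 ge_min lexx /= andbT.
apply: divr_ge0; last exact: head_ge0.
by apply: mulr_ge0; [have := tail_itv y; lra|exact: gauge_ge0].
Qed.

Lemma ratio_gt0 y : box a b y -> 0 < head y -> 0 < ratio y.
Proof.
move=> hy h0; rewrite /ratio lt_min ltr01 /=.
apply: divr_gt0 => //; apply: mulr_gt0; last exact: gauge_gt0.
by have := tail_itv y; lra.
Qed.

Lemma ball_box (y : K -> R) : ball1_between a b y -> box a b y.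
Proof. by case. Qed.

Lemma dilate_box c y : 0 <= c <= 1 -> box a b y -> box a b (dilate c y).
Proof.
move=> /andP[c0 c1] hy i; rewrite /dilate; case: ifP => _; last exact: hy.
have /andP[ay yb] := hy i; have := hb i; have /andP[_ a0] := ha i => b0.
by apply/andP; split; nra.
Qed.

Lemma dilate_cancel y : box a b y ->
  dilate (ratio (dilate (ratio y) y))^-1 (dilate (ratio y) y) = y.
Proof.
move=> hy; have := head_ge0 y; rewrite [X in is_true X -> _]le_eqVlt => /orP[/eqP/esym h0|h0].
  by rewrite !(dilate_head0 _ h0).
have r0 := ratio_gt0 hy h0.
by rewrite ratio_dilate// dilateM mulVf ?dilate1// gt_eqF.
Qed.

(* [ratio y] depends only on the ray through the head of y and on its tail, so
   dilating by it is inverted by dilating by the inverse ratio. If the head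
   vanishes, then [ratio y = 0] since 0 / 0 = 0, and nothing is dilated. *)
Lemma dilate_bij : set_bij (box a b) (ball1_between a b) (fun y => dilate (ratio y) y).
Proof.
split.
- move=> y hy; have hd := dilate_box (ratio_itv y) hy.
  split; last exact: hd.
  have /andP[r0 r1] := ratio_itv y; have /andP[t0 t1] := tail_itv y.
  rewrite esum_head_tail// lee_fin tail_dilate head_dilate//.
  have g1 := gauge_le1 hy; have g0 := gauge_ge0 y.
  suff : ratio y * head y <= (1 - tail y) * gauge y.
    have : (1 - tail y) * gauge y <= (1 - tail y) * 1 by apply: ler_wpM2l; lra.
    by lra.
  have := head_ge0 y; rewrite [X in is_true X -> _]le_eqVlt => /orP[/eqP/esym ->|h0].
    by rewrite mulr0 mulr_ge0//; lra.
  by rewrite -ler_pdivlMr// /ratio ge_min lexx orbT.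
- move=> y y' /set_mem hy /set_mem hy' e.
  by rewrite -(dilate_cancel hy) -(dilate_cancel hy') e.
- move=> y hy; have by_ := ball_box hy; have [y1 _] := hy.
  have := head_ge0 y; rewrite [X in is_true X -> _]le_eqVlt => /orP[/eqP/esym h0|h0].
    by exists y => //; rewrite dilate_head0.
  have r0 := ratio_gt0 by_ h0.
  have ri0 : 0 < (ratio y)^-1 by rewrite invr_gt0.
  exists (dilate (ratio y)^-1 y).
    move=> i; rewrite /dilate; case: ifP => is_; last exact: by_.
    have /andP[ay yb] := by_ i; have b0 := hb i; have /andP[_ a0] := ha i.
    have gr : gauge y <= ratio y.
      rewrite /ratio le_min gauge_le1//= ler_pdivlMr// mulrC.
      apply: ler_wpM2r; first exact: gauge_ge0.
      by move: y1; rewrite esum_head_tail// lee_fin; lra.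
    have := gauge_ge y is_; rewrite ge_max => /andP[gb ga].
    rewrite mulrC ler_pdivrMr// ler_pdivlMr//; apply/andP; split; last first.
      by rewrite mulrC -ler_pdivrMr//; exact: le_trans gr.
    move: (a0); rewrite [X in is_true X -> _]le_eqVlt => /orP[/eqP az|an].
      by rewrite az mul0r -az.
    by rewrite mulrC -ler_ndivrMr//; exact: le_trans gr.
  by rewrite ratio_dilate// dilateM divff ?dilate1// gt_eqF.
Qed.

Lemma continuous_tail : continuous (tail : {ptws K -> R} -> R).
Proof.
apply: (@continuous_dominated_esum _ _ _
  (fun i (y : {ptws K -> R}) => `|clamp i (y i)|) b) => //.
  move=> i; apply: continuous_abs => y.
  apply: (@continuous_max _ _ (cst (a i)) (fun y : {ptws K -> R} => Num.min (b i) (y i))).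
    exact: cst_continuous.
  apply: (@continuous_min _ _ (cst (b i)) (fun y : {ptws K -> R} => y i)).
    exact: cst_continuous.
  exact: ptws_eval_continuous.
by move=> i y; rewrite normr_ge0 clamp_le.
Qed.

Lemma continuous_head : continuous (head : {ptws K -> R} -> R).
Proof.
apply: (@continuous_sum_seq R _ _ (fun i (y : {ptws K -> R}) => `|y i|)) => i.
exact/continuous_abs/ptws_eval_continuous.
Qed.

Lemma continuous_gauge : continuous (gauge : {ptws K -> R} -> R).
Proof.
apply: (@continuous_bigmax_seq _ _
  (fun i (y : {ptws K -> R}) => Num.max (y i / b i) (y i / a i))) => i y.
by apply: (@continuous_max _ _ (fun y : {ptws K -> R} => y i / b i)
    (fun y : {ptws K -> R} => y i / a i)); apply: continuous_mul;
  [exact: ptws_eval_continuous|exact: cst_continuous|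
   exact: ptws_eval_continuous|exact: cst_continuous].
Qed.

Lemma continuous_dilate i :
  continuous (fun y : {ptws K -> R} => dilate (ratio y) y i).
Proof.
rewrite /dilate; case is_ : (i \in s); last exact: ptws_eval_continuous.
move=> y; have [h0|h0] := eqVneq (head y) 0; last first.
  apply: (@continuous_at_mul _ (ratio : {ptws K -> R} -> R)
    (fun y : {ptws K -> R} => y i)); last exact: ptws_eval_continuous.
  apply: (@continuous_min _ _ (cst 1) (fun y : {ptws K -> R} =>
    (1 - tail y) * gauge y / head y)); first exact: cst_continuous.
  apply: (@continuous_at_mul _ (fun y : {ptws K -> R} => (1 - tail y) * gauge y)
    (fun y : {ptws K -> R} => (head y)^-1)).
    apply: continuous_mul; last exact: continuous_gauge.
    by apply: continuous_sub; [exact: cst_continuous|exact: continuous_tail].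
  by apply: continuous_at_inv => //; exact: continuous_head.
apply: (@continuous_at_squeeze0 _ _ (fun y : {ptws K -> R} => y i)).
- move=> x; have /andP[r0 r1] := ratio_itv x.
  by rewrite normrM ger0_norm// ler_piMl.
- exact: head0 is_.
- exact: ptws_eval_continuous.
Qed.

Lemma box_ball_homeomorphic : homeomorphic (box a b) (ball1_between a b).
Proof.
apply: (ptws_homeomorphic (A := b) (@closed_box R K a b) _ _ dilate_bij).
  move=> y hy i; have /andP[ay yb] := hy i; have /andP[ba a0] := ha i.
  by rewrite ler_norml yb andbT; apply: le_trans ay.
by move=> i; apply: continuous_subspaceT; exact: continuous_dilate.
Qed.

End radial.

Lemma cube_box_homeomorphic (K : choiceType) (a b : K -> R) :
  (forall i, a i < b i) -> homeomorphic (cube R K) (box a b).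
Proof.
move=> ab; apply: (ptws_homeomorphic (A := fun=> 1)
  (f := fun t i => a i + t i * (b i - a i)) (@closed_cube R K)).
- by move=> t t01 i; have /andP[t0 t1] := t01 i; rewrite ger0_norm.
- move=> i; apply: continuous_subspaceT; apply: continuous_add.
    exact: cst_continuous.
  by apply: continuous_mul; [exact: ptws_eval_continuous|exact: cst_continuous].
split.
- by move=> t t01 i; have /andP[t0 t1] := t01 i; have := ab i => ?; nra.
- move=> t t' _ _ /funeqP e; apply/funext => i.
  have /addrI/mulIf := e i; apply.
  by rewrite subr_eq0 gt_eqF.
- move=> y hy; exists (fun i => (y i - a i) / (b i - a i)).
    move=> i; have /andP[ay yb] := hy i; have := ab i => h.
    by rewrite divr_ge0 ?ler_pdivrMr ?subr_gt0//; lra.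
  by apply/funext => i; rewrite divfK ?subrKC// subr_eq0 gt_eqF.
Qed.

Lemma summable_ball_cube (K : choiceType) (a b : K -> R) :
  (forall i, - b i <= a i <= 0) -> (forall i, 0 < b i) ->
  (\esum_(i in [set: K]) (b i)%:E < +oo)%E ->
  homeomorphic (ball1_between a b) (cube R K).
Proof.
move=> ha hb hsum.
have h2 : (0 : R) < 2^-1 by rewrite invr_gt0.
have [s us hs] := esum_small_tail (fun i => ltW (hb i)) hsum h2.
apply: homeomorphic_sym; apply: (@homeomorphic_trans _ _ _ _ (box a b)).
  by apply: cube_box_homeomorphic => i; have := ha i; have := hb i; lra.
exact: box_ball_homeomorphic us hs.
Qed.

End summable_box.

(** * Conclusion *)

Section main.
Context {R : realType}.

Lemma ball1_between_reindex (I K : choiceType) (e : I -> K) (a b : K -> R) :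
  set_bij [set: I] [set: K] e ->
  homeomorphic (ball1_between a b) (ball1_between (a \o e) (b \o e)).
Proof.
move=> ebij; have [_ einj esurj] := ebij.
have esumE (x : K -> R) : (\esum_(i in [set: K]) `|x i|%:E =
    \esum_(i in [set: I]) `|x (e i)|%:E)%E by rewrite (reindex_esum setT setT e).
apply: (ptws_homeomorphic (A := fun=> 1) (f := fun x => x \o e)
  (@closed_ball1_between _ _ a b)).
- exact: ball1_between_le1.
- by move=> l; apply: continuous_subspaceT; exact: ptws_eval_continuous.
split.
- by move=> x [x1 xab]; split => [|i]; [rewrite -esumE|exact: xab].
- move=> x y _ _ /funeqP xy; apply/funext => k.
  have [i _ <-] := esurj k Logic.I; exact: xy.
- move=> y [y1 yab].
  have /choice[g gK] : forall k, exists i, e i = k.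
    by move=> k; have [i _ <-] := esurj k Logic.I; exists i.
  have ge i : g (e i) = i.
    by apply: einj; rewrite ?in_setT// gK.
  exists (y \o g); last by apply/funext => i /=; rewrite ge.
  split; last by move=> k; have := yab (g k); rewrite /= gK.
  by rewrite esumE; under eq_esum do rewrite /= ge.
Qed.

Lemma cube_reindex (I K : choiceType) (e : I -> K) :
  set_bij [set: I] [set: K] e -> homeomorphic (cube R K) (cube R I).
Proof.
move=> [_ einj esurj].
apply: (ptws_homeomorphic (A := fun=> 1) (f := fun x => x \o e) (@closed_cube R K)).
- by move=> t t01 i; have /andP[t0 t1] := t01 i; rewrite ger0_norm.
- by move=> l; apply: continuous_subspaceT; exact: ptws_eval_continuous.
split.
- by move=> x x01 i; exact: x01.
- move=> x y _ _ /funeqP xy; apply/funext => k.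
  have [i _ <-] := esurj k Logic.I; exact: xy.
- move=> y y01.
  have /choice[g gK] : forall k, exists i, e i = k.
    by move=> k; have [i _ <-] := esurj k Logic.I; exists i.
  have ge i : g (e i) = i.
    by apply: einj; rewrite ?in_setT// gK.
  by exists (y \o g) => [k|]; [exact: y01|apply/funext => i /=; rewrite ge].
Qed.

(** Only the ambient space changes, from a power of R to a power of the subtype [-1, 1]; the default
    of [insubd] is never reached on the ball. *)
Lemma ball1_homeomorphic (K : choiceType) :
  homeomorphic (ball1_between (fun _ : K => -1 : R) (fun=> 1)) (ball1 R K).
Proof.
have h0 : (0 : R) \in `[-1, 1]%classic by rewrite inE /= in_itv/=; lra.
pose z0 : (`[-1, 1]%classic : set R) := SigSub h0.
pose f (x : {ptws K -> R}) : {ptws K -> (`[-1, 1]%classic : set R)} :=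
  fun i => insubd z0 (x i).
have fE x i : -1 <= x i <= 1 -> set_val (f x i) = x i.
  by move=> hx; apply: insubdK; apply/mem_set; rewrite /= in_itv.
apply: (@continuous_bij_homeomorphic _ _ _ _ f).
- apply: (ptws_compact (A := fun=> 1)); first exact: closed_ball1_between.
  exact: ball1_between_le1.
- by apply: hausdorff_product => i; apply: hausdorff_set_type; exact: Rhausdorff.
- apply/subspace_sigL_continuousP; apply: ptws_continuous => i.
  apply: continuous_into_set_type.
  rewrite (_ : (fun _ => _) = fun x : ball1_between (fun=> -1) (fun=> 1) => set_val x i).
    apply: (@continuous_set_type _ _ _ (fun x : {ptws K -> R} => x i)).
    by apply: continuous_subspaceT; exact: ptws_eval_continuous.
  apply/funext => x; rewrite /sigL /= fE//.
  by have [_ /(_ i)] := set_valP x.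
split.
- move=> x [x1 xab]; rewrite /ball1 /=.
  by under eq_esum do rewrite fE//.
- move=> x y /set_mem[_ xab] /set_mem[_ yab] /funeqP xy; apply/funext => i.
  by rewrite -(fE x i)// -(fE y i)// xy.
- move=> y y1; have yab i : -1 <= set_val (y i) <= 1.
    by have := set_valP (y i); rewrite /= in_itv.
  exists (fun i => set_val (y i)) => //.
  by apply/funext => i; apply: val_inj; rewrite [LHS]fE.
Qed.

(** If c is not 0, it is the endpoint nearest to 0 of an interval on one side of 0, and t points
    away from 0. *)
Lemma norm_add_nearest (a b t : R) : a < b ->
  let c := Num.max a (Num.min b 0) in
  a <= c + t <= b -> `|c + t| = `|c| + `|t|.
Proof.
move=> ab c /andP[h1 h2].
have [a0|a0] := lerP a 0; last first.
  have cE : c = a by rewrite /c (min_r (_ : 0 <= b)) ?max_l//; lra.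
  by rewrite cE in h1 h2 *; rewrite !ger0_norm//; lra.
have [b0|b0] := lerP 0 b; last first.
  have cE : c = b by rewrite /c (min_l (ltW b0)) max_r//; lra.
  by rewrite cE in h1 h2 *; rewrite !ler0_norm//; lra.
have -> : c = 0 by rewrite /c min_r// max_r.
by rewrite add0r normr0 add0r.
Qed.

Lemma norm_nearest (a b : R) : a < b ->
  `|Num.max a (Num.min b 0)| = Num.max a 0 + Num.max (- b) 0.
Proof.
move=> ab; have [a0|a0] := lerP a 0; have [b0|b0] := lerP 0 b.
- by rewrite max_r// normr0 (max_r (_ : - b <= 0)) ?addr0//; lra.
- by rewrite (max_r (ltW ab)) ltr0_norm// max_l ?add0r//; lra.
- by rewrite max_l ?(ltW a0)// gtr0_norm// max_r ?addr0//; lra.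
- lra.
Qed.

(* Recentre at the point c i of least absolute value of each interval, where
   `|c i + t| = `|c i| + `|t|, rescale by 1 - mu, and reflect the coordinates
   whose left part is the longer. *)
Lemma ball1_between_normalize (K : choiceType) (a b : K -> R) :
  (forall i, -1 <= a i <= 1) -> (forall i, -1 <= b i <= 1) ->
  (forall i, a i < b i) -> (mu a b < 1)%E ->
  exists (a' b' : K -> R) (C : R),
    [/\ forall i, - b' i <= a' i <= 0, forall i, 0 < b' i <= C &
        homeomorphic (ball1_between a' b') (ball1_between a b)].
Proof.
move=> ha hb ab hmu.
pose c i := Num.max (a i) (Num.min (b i) 0).
have cab i : a i <= c i <= b i.
  by rewrite /c le_max lexx /= ge_max (ltW (ab i)) ge_min lexx.
have muE : mu a b = (\esum_(i in [set: K]) `|c i|%:E)%E.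
  by apply: eq_esum => i _; rewrite norm_nearest.
have muE' := esum_fin_num (D := setT) (f := fun i => `|c i|) (fun i => normr_ge0 _).
rewrite -muE in muE'; have {}muE' := muE' (lt_trans hmu (ltry _)).
pose r := 1 - fine (mu a b).
have r0 : 0 < r by move: hmu; rewrite muE' lte_fin /r; lra.
pose s i : R := if c i - a i <= b i - c i then 1 else -1.
have s2 i : s i * s i = 1 by rewrite /s; case: ifP => _; ring.
have ns i : `|s i| = 1 by rewrite /s; case: ifP => _; rewrite ?normrN normr1.
pose b' i := Num.max (b i - c i) (c i - a i) / r.
pose a' i := - (Num.min (b i - c i) (c i - a i) / r).
have box_iff i t : (a' i <= t <= b' i) = (a i <= c i + r * (s i * t) <= b i).
  rewrite /a' /b' -mulNr ler_pdivrMr// ler_pdivlMr// (mulrC t) /s.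
  have [h|h] := lerP (c i - a i) (b i - c i).
    by apply/idP/idP => /andP[h1 h2]; apply/andP; split; lra.
  by apply/idP/idP => /andP[h1 h2]; apply/andP; split; lra.
pose f (y : {ptws K -> R}) : {ptws K -> R} := fun i => c i + r * (s i * y i).
have addr_iff (S : \bar R) : ((1 - r)%:E + S <= 1)%E = (S <= r%:E)%E.
  case: S => [e| |].
  - by rewrite -EFinD !lee_fin; apply/idP/idP; lra.
  - by rewrite addey// !leye_eq.
  - by rewrite addeNy !leNye.
have sum_iff y : (forall i, a' i <= y i <= b' i) ->
    (\esum_(i in [set: K]) `|f y i|%:E <= 1)%E <->
    (\esum_(i in [set: K]) `|y i|%:E <= 1)%E.
  move=> hy.
  have -> : (\esum_(i in [set: K]) `|f y i|%:E =
      (1 - r)%:E + \esum_(i in [set: K]) (r * `|y i|)%:E)%E.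
    rewrite (_ : 1 - r = fine (mu a b)); last by rewrite /r; ring.
    rewrite -muE' muE -esumD => [|i _|i _]; last 2 first.
    - by rewrite lee_fin.
    - by rewrite lee_fin mulr_ge0// ltW.
    apply: eq_esum => i _; rewrite -EFinD /f norm_add_nearest//.
      by rewrite !normrM ns mul1r (gtr0_norm r0).
    by rewrite -/(c i) -box_iff.
  rewrite addr_iff.
  split=> h.
    apply/(esum_leP (f := fun i => `|y i|)) => // t ut.
    move/(esum_leP (f := fun i => r * `|y i|)): h => /(_ _ t ut).
    rewrite -mulr_sumr -[X in _ <= X]mulr1 ler_pM2l//; apply.
    by move=> i; rewrite mulr_ge0// ltW.
  apply/(esum_leP (f := fun i => r * `|y i|)) => [i|t ut].
    by rewrite mulr_ge0// ltW.
  move/(esum_leP (f := fun i => `|y i|)): h => /(_ _ t ut) h.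
  by rewrite -mulr_sumr -[X in _ <= X]mulr1 ler_pM2l//; exact: h.
(* The constant 2 bounds the length of an interval contained in [-1, 1]. *)
exists a', b', (2 / r); split.
- move=> i; rewrite /a' /b'; apply/andP; split.
    rewrite lerN2 ler_pM2r ?invr_gt0//.
    by rewrite ge_min !le_max !lexx.
  rewrite oppr_le0 divr_ge0 ?(ltW r0)// le_min.
  by have := cab i; lra.
- move=> i; rewrite /b'; apply/andP; split.
    apply: divr_gt0 => //; rewrite lt_max.
    have := ab i; have [h|h] := ltrP 0 (b i - c i); first by [].
    by move=> h' /=; lra.
  rewrite ler_pM2r ?invr_gt0// ge_max.
  by have := cab i; have := ha i; have := hb i; lra.
apply: (ptws_homeomorphic (A := fun=> 1) (f := f)); first exact: closed_ball1_between.
- exact: ball1_between_le1.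
- move=> i; apply: continuous_subspaceT.
  apply: continuous_add; first exact: cst_continuous.
  apply: continuous_mul; first exact: cst_continuous.
  by apply: continuous_mul; [exact: cst_continuous|exact: ptws_eval_continuous].
split.
- move=> y [y1 hy]; split; first exact/(sum_iff y hy).
  by move=> i; rewrite -box_iff.
- move=> y y' _ _ /funeqP e; apply/funext => i.
  have := e i; rewrite /f => /addrI/mulfI; rewrite gt_eqF// => /(_ isT).
  by move/(congr1 (fun u => s i * u)); rewrite !mulrA s2 !mul1r.
- move=> x [x1 hx].
  pose y i := s i * ((x i - c i) / r).
  have fy : f y = x.
    apply/funext => i; rewrite /f /y [s i * _]mulrA s2 mul1r mulrC divfK ?gt_eqF//.
    by ring.
  have hy i : a' i <= y i <= b' i.
    by rewrite box_iff -[X in _ <= X <= _]/(f y i) fy; exact: hx.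
  exists y => //; split => //.
  by apply/(sum_iff y hy); rewrite fy.
Qed.

(** For finite K the constant bound 1 is summable. For infinite K it diverges, so one block indexed
    by [unit * nat] leads to the simplex and from there to the cube. *)
Lemma ball_cube (K : choiceType) : countable [set: K] ->
  homeomorphic (ball1_between (fun _ : K => -1 : R) (fun=> 1)) (cube R K).
Proof.
move=> cK; have [finK|infK] := pselect (finite_set [set: K]).
  apply: summable_ball_cube => [i|i|]; [lra|lra|].
  rewrite esum_fset//; first by rewrite fsbig_finite//= sumEFin ltry.
have [g [gbij _]] : exists g : nat -> K, set_bij [set: nat] [set: K] g /\
    (\esum_(n in [set: nat]) ((fun _ : K => 1) (g n))%:E = +oo :> \bar R)%E.
  apply: (@divergent_enum R K (fun=> 1) setT) => //; split => //.
  by apply: (esum_infinite_lb ltr01).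
have ebij : set_bij [set: unit * nat] [set: K] (fun p => g p.2).
  have [_ ginj gsurj] := gbij; split => //.
  - move=> [[] m] [[] n] _ _ /= e; congr (_, _).
    by apply: ginj => //; rewrite in_setT.
  - by move=> k _; have [n _ <-] := gsurj k Logic.I; exists (tt, n).
apply: homeomorphic_trans (ball1_between_reindex _ _ ebij) _.
apply: homeomorphic_trans _ (homeomorphic_sym (cube_reindex gbij)).
apply: homeomorphic_trans _ (homeomorphic_sym cube_simplex_homeomorphic).
apply: (@divergent_ball_simplex _ _ _ _ 1) => [p|p|j]; [rewrite /=; lra|rewrite /=; lra|].
by apply: (esum_infinite_lb ltr01) => //; exact: infinite_nat.
Qed.

End main.

Theorem theorem1 (R : realType) (K : choiceType) (a b : K -> R)
  (ha : forall i, -1 <= a i <= 1) (hb : forall i, -1 <= b i <= 1)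
  (hab : forall i, a i < b i) (hmu : (mu a b < 1)%E) :
  homeomorphic (ball1_between a b) (ball1 R K).
Proof.
have [a' [b' [C [ha' hb' hn]]]] := ball1_between_normalize ha hb hab hmu.
apply: homeomorphic_trans (homeomorphic_sym hn) _.
apply: homeomorphic_trans _ (ball1_homeomorphic K).
have b0 i : 0 < b' i by case/andP: (hb' i).
have [boo|[J [e [ebij einf]]]] := block_decomposition b0.
  apply: homeomorphic_trans (summable_ball_cube ha' b0 boo) _.
  exact/homeomorphic_sym/ball_cube/(esum_lty_countable b0 boo).
apply: homeomorphic_trans (ball1_between_reindex _ _ ebij) _.
apply: homeomorphic_trans _ (homeomorphic_sym (ball1_between_reindex _ _ ebij)).
apply: (@homeomorphic_trans _ _ _ _ (simplex R (J * nat)%type)).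
  by apply: (@divergent_ball_simplex _ _ _ _ C) => // p; [exact: ha'|exact: hb'].
apply: homeomorphic_sym.
apply: (@divergent_ball_simplex _ _ _ _ 1) => [p|p|j]; [rewrite /=; lra|rewrite /=; lra|].
by apply: (esum_infinite_lb ltr01) => //; exact: infinite_nat.
Qed.
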